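(* Let $(P,\mathcal T)$ be a hybrid program, $G=C_0,\bar L$ a goal with constraint $C_0$, $M_0$ a model of $\mathcal T$ and $k$ a countable ordinal. Assume that $M_0$ is a Herbrand interpretation, or the set of constraints has the witness property, or $P$ is safe. Let $\theta$ be a substitution mapping the free variables of $G$ to ground terms. (1) If $C$ is an answer of a t-tree of rank $k$ for $G$ and $M_0\models C\theta$, then $\Psi_{P/M_0}\!\uparrow\!(k+1)\models_3\bar L\theta$. (2) If $C$ is a negative answer of a tu-tree of rank $k$ for $G$, $M_0\models C_0\theta$ and $M_0\models C\theta$, then $\Psi_{P/M_0}\!\uparrow\!(k+1)\models_3\neg(\bar L\theta)$ (i.e. some literal of $\bar L\theta$ is false there).
   Context: Setting: rule predicates $\mathcal P_R$, constraint predicates $\mathcal P_C$, function symbols $\mathcal F$ (with a constant); external theory $\mathcal T$ (first-order axioms over $\mathcal P_C,\mathcal F$, 2-valued semantics); $=$ is a constraint predicate, $\mathcal T$ contains Clark's equality theory, term equalities are constraints and constraints are closed under $\wedge,\vee,\neg,\exists$. A hybrid rule is $H\leftarrow C,L_1,\dots,L_n$ ($H$ rule atom, $L_i$ rule literals, $C$ a constraint); a hybrid program $(P,\mathcal T)$ has $P$ a set of hybrid rules. $\mathcal H$ = ground rule atoms over $\mathcal F$. For a model $M_0$ of $\mathcal T$, $P/M_0$ is the ground normal program of all $H\theta\leftarrow L_1\theta,\dots,L_n\theta$ with $\theta$ grounding the free variables of a rule $H\leftarrow C,\bar L$ of $P$ and $M_0\models C\theta$. For a ground normal program $Q$ and $I\subseteq\mathcal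 H\cup\neg\mathcal H$ (treating $\neg p$ as a fresh predicate): $Q/_tI=Q\cup\{\neg A\mid\neg A\in I\}$, $Q/_{tu}I=Q\cup\{\neg A\mid A\in\mathcal H,A\notin I\}$, $\Psi_Q(I)=(\mathcal M_{Q/_tI}\cap\mathcal H)\cup\neg(\mathcal H\setminus\mathcal M_{Q/_{tu}I})$ with $\mathcal M_R$ the least Herbrand model of definite $R$; $\Psi_Q\!\uparrow\!0=\emptyset$, $\Psi_Q\!\uparrow\!(\alpha+1)=\Psi_Q(\Psi_Q\!\uparrow\!\alpha)$, $\Psi_Q\!\uparrow\!\lambda=\bigcup_{\alpha<\lambda}\Psi_Q\!\uparrow\!\alpha$ for limit $\lambda$. Such a set is a 3-valued interpretation (literal true if in the set, false if its complement is, else undefined), $\models_3$ Kleene evaluation. Witness property: for every model $M$ of $\mathcal T$ and constraint $C$, $M\models\exists C$ implies $M\models C\sigma$ for some substitution $\sigma$ mapping the free variables of $C$ to ground terms. A constraint is satisfiable if it is true in some model of $\mathcal T$ under some assignment. Variable $x$ is bound in $C$ to ground term $t$ (variable $y$) if $\mathcal T\models C\to x=t$ ($C\to x=y$). A rule $H\leftarrow C,\bar L$ is safe if every variable of $H$, of a negative literal of $\bar L$, and every free variable of $C$ is bound in $C$ to a ground term or a variable occurring in a positive literal of $\bar L$; $P$ is safe if all its rules are. A goal is $C,L_1,\dots,L_n$ with $C$ a constraint and $L_i$ rule literals. $F|_V=\exists x_1\dots x_m F$, $x_i$ the free variables of $F$ not in $V$; $F|_{F'}=F|_{\mathrm{free}(F')}$.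 Derivation: from goal $C,\bar L,p(\bar t),\bar L'$ and a variable-disjoint rule $p(\bar u)\leftarrow C',\bar K$, the goal $\bar t=\bar u,C,C',\bar L,\bar K,\bar L'$ is derived if $\bar t=\bar u,C,C'$ is satisfiable. t-trees and tu-trees of rank $k$ for goal $G$ (simultaneous induction on $k$): trees of goals rooted at $G$, one rule literal selected in each node containing one, nodes without rule literals successful. (i) If the selected literal of $G'$ is an atom, the children are all goals derived from $G'$ by variants of rules of $P$ with variables not occurring on the path from the root to $G'$. (ii) If $G'=C,\bar L,\neg A,\bar L'$ with $\neg A$ selected: in a t-tree, $G'$ is a leaf or has single child $C',C,\bar L,\bar L'$ with $C'$ a negative answer of a tu-tree of rank $<k$ for $C,A$ and $C',C$ satisfiable; in a tu-tree, $G'$ has single child $C,\bar L,\bar L'$, or single child $\neg C'',C,\bar L,\bar L'$ with $C''$ an answer of a t-tree of rank $<k$ for $C,A$ and $\neg C'',C$ satisfiable, or $G'$ is a leaf and some answer $C''$ of a t-tree of rank $<k$ for $C,A$ makes $\neg C'',C$ unsatisfiable. An answer of a t-tree rooted at $G$ is $(C_1\vee\dots\vee C_n)|_G$ ($n\ge0$) with $C_i$ constraints of successful leaves. A cross-section of a tu-tree is a set of nodes meeting every branch ending in a successful leaf; if its node constraints form a finite set $\{C_1,\dots,C_n\}$ then $\neg(C_1|_G)\wedge\dots\wedge\neg(C_n|_G)$ is a negative answer; if infinite, any constraint $C$ with free variables among those of $G$ and $\mathcal T\models C\to\neg(C_i|_G)$ for every $C_i$ is a negative answer. *)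

(* Defs.v *)
From Stdlib Require Import List Arith Bool.
Import ListNotations.

Section Hybrid.

(* Signature: function symbols F (with arities, and a constant c0),
   rule predicates PR, constraint predicates PC.                      *)
Variables (F PR PC : Type).

Inductive term : Type := Var (x : nat) | App (f : F) (ts : list term).

Inductive cform : Type :=
| CEq (t u : term)
| CAt (p : PC) (ts : list term)
| CNot (c : cform)
| CAnd (c d : cform)
| COr (c d : cform)
| CEx (x : nat) (c : cform).

Inductive atom : Type := RA (p : PR) (ts : list term).
Inductive lit : Type := Pos (a : atom) | Neg (a : atom).

Record rule : Type := Rule { rhead : atom; rcon : cform; rbody : list lit }.
Record goal : Type := Goal { gcon : cform; glits : list lit }.

Variables (arF : F -> nat) (arR : PR -> nat) (arC : PC -> nat).
Variable c0 : F.   (* the constant of the signature; arF c0 = 0 is assumed in the theorem *)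

Fixpoint fvt (t : term) : list nat :=
  match t with
  | Var x => [x]
  | App _ ts => (fix g (l : list term) := match l with [] => [] | u :: l' => fvt u ++ g l' end) ts
  end.

Definition fvts (ts : list term) : list nat := flat_map fvt ts.

Fixpoint wft (t : term) : Prop :=
  match t with
  | Var _ => True
  | App f ts => length ts = arF f /\
      (fix g (l : list term) := match l with [] => True | u :: l' => wft u /\ g l' end) ts
  end.

Definition gwft (t : term) : Prop := wft t /\ fvt t = [].

Fixpoint tsubst (s : nat -> term) (t : term) : term :=
  match t with
  | Var x => s x
  | App f ts => App f (map (tsubst s) ts)
  end.

Definition tren (pi : nat -> nat) (t : term) : term := tsubst (fun x => Var (pi x)) t.

Fixpoint fvc (c : cform) : list nat :=
  match c with
  | CEq t u => fvt t ++ fvt u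
  | CAt _ ts => fvts ts
  | CNot c => fvc c
  | CAnd c d => fvc c ++ fvc d
  | COr c d => fvc c ++ fvc d
  | CEx x c => filter (fun y => negb (Nat.eqb y x)) (fvc c)
  end.

Fixpoint varsc (c : cform) : list nat :=
  match c with
  | CEq t u => fvt t ++ fvt u
  | CAt _ ts => fvts ts
  | CNot c => varsc c
  | CAnd c d => varsc c ++ varsc d
  | COr c d => varsc c ++ varsc d
  | CEx x c => x :: varsc c
  end.

Fixpoint wfc (c : cform) : Prop :=
  match c with
  | CEq t u => wft t /\ wft u
  | CAt p ts => length ts = arC p /\ Forall wft ts
  | CNot c => wfc c
  | CAnd c d => wfc c /\ wfc d
  | COr c d => wfc c /\ wfc d
  | CEx _ c => wfc c
  end.

Fixpoint cren (pi : nat -> nat) (c : cform) : cform :=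
  match c with
  | CEq t u => CEq (tren pi t) (tren pi u)
  | CAt p ts => CAt p (map (tren pi) ts)
  | CNot c => CNot (cren pi c)
  | CAnd c d => CAnd (cren pi c) (cren pi d)
  | COr c d => COr (cren pi c) (cren pi d)
  | CEx x c => CEx (pi x) (cren pi c)
  end.

Definition fva (a : atom) : list nat := match a with RA _ ts => fvts ts end.
Definition wfa (a : atom) : Prop := match a with RA p ts => length ts = arR p /\ Forall wft ts end.
Definition asubst (s : nat -> term) (a : atom) : atom :=
  match a with RA p ts => RA p (map (tsubst s) ts) end.
Definition gwfa (a : atom) : Prop := wfa a /\ fva a = [].

Definition litatom (l : lit) : atom := match l with Pos a => a | Neg a => a end.
Definition fvl (l : lit) : list nat := fva (litatom l).
Definition wfl (l : lit) : Prop := wfa (litatom l).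
Definition lsubst (s : nat -> term) (l : lit) : lit :=
  match l with Pos a => Pos (asubst s a) | Neg a => Neg (asubst s a) end.

Definition ren_rule (pi : nat -> nat) (r : rule) : rule :=
  Rule (asubst (fun x => Var (pi x)) (rhead r)) (cren pi (rcon r))
       (map (lsubst (fun x => Var (pi x))) (rbody r)).

Definition rule_vars (r : rule) : list nat :=
  fva (rhead r) ++ varsc (rcon r) ++ flat_map fvl (rbody r).

Definition wf_rule (r : rule) : Prop :=
  wfa (rhead r) /\ wfc (rcon r) /\ Forall wfl (rbody r).

Definition variant (r' r : rule) : Prop :=
  exists pi : nat -> nat, (forall x y, pi x = pi y -> x = y) /\
    (forall y, exists x, pi x = y) /\ r' = ren_rule pi r.

Definition fvg (g : goal) : list nat := fvc (gcon g) ++ flat_map fvl (glits g).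
Definition goal_vars (g : goal) : list nat := varsc (gcon g) ++ flat_map fvl (glits g).

Definition CTrue : cform := CEq (App c0 []) (App c0 []).
Definition CFalse : cform := CNot CTrue.

Fixpoint disj (cs : list cform) : cform :=
  match cs with [] => CFalse | [c] => c | c :: cs' => COr c (disj cs') end.
Fixpoint conj (cs : list cform) : cform :=
  match cs with [] => CTrue | [c] => c | c :: cs' => CAnd c (conj cs') end.

Definition eqs (ts us : list term) : cform :=
  conj (map (fun p => CEq (fst p) (snd p)) (combine ts us)).

Definition restrict (c : cform) (V : list nat) : cform :=
  fold_right CEx c (filter (fun x => negb (existsb (Nat.eqb x) V)) (fvc c)).

Record structure : Type := Struct {
  dom : Type;
  fn : F -> list dom -> dom;
  pr : PC -> list dom -> Prop }.

Fixpoint eval (M : structure) (a : nat -> dom M) (t : term) : dom M :=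
  match t with
  | Var x => a x
  | App f ts => fn M f (map (eval M a) ts)
  end.

Definition upd (M : structure) (a : nat -> dom M) (x : nat) (d : dom M) : nat -> dom M :=
  fun y => if Nat.eqb y x then d else a y.

Fixpoint sat (M : structure) (a : nat -> dom M) (c : cform) : Prop :=
  match c with
  | CEq t u => eval M a t = eval M a u
  | CAt p ts => pr M p (map (eval M a) ts)
  | CNot c => ~ sat M a c
  | CAnd c d => sat M a c /\ sat M a d
  | COr c d => sat M a c \/ sat M a d
  | CEx x c => exists d : dom M, sat M (upd M a x d) c
  end.

(* value of a ground term (the assignment is irrelevant for ground terms) *)
Definition geval (M : structure) (t : term) : dom M :=
  eval M (fun _ => fn M c0 []) t.

Definition sat_inst (M : structure) (theta : nat -> term) (c : cform) : Prop :=
  sat M (fun x => geval M (theta x)) c.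

Variable Constr : cform -> Prop.
Variable Th : cform -> Prop.
Variable P : rule -> Prop.

Definition model (M : structure) : Prop := forall phi, Th phi -> forall a, sat M a phi.

Definition entails (c d : cform) : Prop :=
  forall M, model M -> forall a, sat M a c -> sat M a d.

Definition satisfiable (c : cform) : Prop :=
  exists M, model M /\ exists a, sat M a c.

Definition CET (M : structure) : Prop :=
  (forall f xs ys, length xs = arF f -> length ys = arF f -> fn M f xs = fn M f ys -> xs = ys) /\
  (forall f g xs ys, f <> g -> length xs = arF f -> length ys = arF g -> fn M f xs <> fn M g ys) /\
  (forall t x (a : nat -> dom M), wft t -> In x (fvt t) -> t <> Var x -> eval M a t <> a x).

Definition constraint_language : Prop :=
  (forall t u, Constr (CEq t u)) /\
  (forall c, Constr c -> Constr (CNot c)) /\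
  (forall c d, Constr c -> Constr d -> Constr (CAnd c d)) /\
  (forall c d, Constr c -> Constr d -> Constr (COr c d)) /\
  (forall x c, Constr c -> Constr (CEx x c)).

Definition theory_ok : Prop :=
  (forall phi, Th phi -> wfc phi) /\ (forall M, model M -> CET M).

Definition hybrid_program : Prop :=
  forall r, P r -> wf_rule r /\ Constr (rcon r).

Definition goal_ok (g : goal) : Prop := Constr (gcon g) /\ Forall wfl (glits g).

(* M0 is a Herbrand interpretation: (up to isomorphism) its domain is the
   set of ground terms, each function symbol interpreted by itself *)
Definition herbrand (M : structure) : Prop :=
  (forall d : dom M, exists t, gwft t /\ geval M t = d) /\
  (forall t u, gwft t -> gwft u -> geval M t = geval M u -> t = u).

Definition witness_property : Prop :=
  forall M, model M -> forall c, Constr c ->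
    (exists a, sat M a c) ->
    exists sigma : nat -> term, (forall x, gwft (sigma x)) /\ sat_inst M sigma c.

Definition bound_to (c : cform) (x : nat) (t : term) : Prop := entails c (CEq (Var x) t).

Definition safe_rule (r : rule) : Prop :=
  forall x, (In x (fva (rhead r)) \/
             (exists a, In (Neg a) (rbody r) /\ In x (fva a)) \/
             In x (fvc (rcon r))) ->
    (exists t, gwft t /\ bound_to (rcon r) x t) \/
    (exists y a, In (Pos a) (rbody r) /\ In y (fva a) /\ bound_to (rcon r) x (Var y)).

Definition safe_program : Prop := forall r, P r -> safe_rule r.

Definition ground_prog (M0 : structure) (h : atom) (ls : list lit) : Prop :=
  exists r, P r /\ exists theta : nat -> term, (forall x, gwft (theta x)) /\
    sat_inst M0 theta (rcon r) /\ h = asubst theta (rhead r) /\ ls = map (lsubst theta) (rbody r).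

(* least Herbrand model (restricted to H) of the definite program Q plus the
   facts  not A  for N A  (not A treated as a fresh atom) *)
Inductive lhm (Q : atom -> list lit -> Prop) (N : atom -> Prop) : atom -> Prop :=
| lhm_rule : forall h ls, Q h ls ->
    (forall a, In (Pos a) ls -> lhm Q N a) ->
    (forall a, In (Neg a) ls -> N a) -> lhm Q N h.

(* 3-valued interpretations are sets of literals *)
Definition interp := lit -> Prop.

Definition Psi (Q : atom -> list lit -> Prop) (I : interp) : interp :=
  fun l => match l with
  | Pos a => lhm Q (fun b => I (Neg b)) a
  | Neg a => gwfa a /\ ~ lhm Q (fun b => gwfa b /\ ~ I (Pos b)) a
  end.

(* countable ordinals as Brouwer trees; OL f denotes sup_n (f n) *)
Inductive ord : Type := OZ | OS (o : ord) | OL (f : nat -> ord).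

Fixpoint psi_up (Q : atom -> list lit -> Prop) (k : ord) : interp :=
  match k with
  | OZ => fun _ => False
  | OS k' => Psi Q (psi_up Q k')
  | OL f => fun l => exists n, psi_up Q (f n) l
  end.

Definition lit_false (I : interp) (l : lit) : Prop :=
  match l with Pos a => I (Neg a) | Neg a => I (Pos a) end.
Definition true3 (I : interp) (ls : list lit) : Prop := forall l, In l ls -> I l.
Definition false3 (I : interp) (ls : list lit) : Prop := exists l, In l ls /\ lit_false I l.

(* from goal g with the n-th literal p(t) selected and rule p(u) <- C', K,
   derive  t=u, C, C', L, K, L'  (satisfiability is checked separately) *)
Definition derives (g : goal) (n : nat) (r : rule) (g' : goal) : Prop :=
  exists p ts us, nth_error (glits g) n = Some (Pos (RA p ts)) /\
    rhead r = RA p us /\ length ts = length us /\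
    g' = Goal (CAnd (eqs ts us) (CAnd (gcon g) (rcon r)))
              (firstn n (glits g) ++ rbody r ++ skipn (S n) (glits g)).

(* trees of goals: nodes are addresses (lists of child indices, the head
   being the last step); children of an atom-selected node are indexed by
   the rule used (Some r), the single child of a negative-literal node by None *)
Definition addr := list (option rule).
Record tree : Type := Tree { tlab : addr -> option goal; tsel : addr -> nat }.

Definition on_path (tr : tree) (a : addr) (x : nat) : Prop :=
  exists b c g, a = c ++ b /\ tlab tr b = Some g /\ In x (goal_vars g).

Definition leaf (tr : tree) (a : addr) : Prop := forall i, tlab tr (i :: a) = None.

Definition single_child (tr : tree) (a : addr) (g' : goal) : Prop :=
  tlab tr (None :: a) = Some g' /\ forall r, tlab tr (Some r :: a) = None.

Definition atom_children (tr : tree) (a : addr) (g : goal) (n : nat) : Prop :=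
  tlab tr (None :: a) = None /\
  forall r,
    (forall g', tlab tr (Some r :: a) = Some g' ->
       P r /\ exists r', variant r' r /\ (forall x, In x (rule_vars r') -> ~ on_path tr a x) /\
         derives g n r' g' /\ satisfiable (gcon g')) /\
    (P r -> (exists r' g', variant r' r /\ (forall x, In x (rule_vars r') -> ~ on_path tr a x) /\
         derives g n r' g' /\ satisfiable (gcon g')) ->
       tlab tr (Some r :: a) <> None).

(* (ii) for t-trees; ltu G C: C is a negative answer of a tu-tree of rank < k for G *)
Definition t_neg (ltu : goal -> cform -> Prop) (tr : tree) (a : addr) (g : goal)
  (A : atom) (rest : list lit) : Prop :=
  leaf tr a \/
  exists C', ltu (Goal (gcon g) [Pos A]) C' /\ satisfiable (CAnd C' (gcon g)) /\
    single_child tr a (Goal (CAnd C' (gcon g)) rest).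

(* (ii) for tu-trees; lt G C: C is an answer of a t-tree of rank < k for G *)
Definition tu_neg (lt : goal -> cform -> Prop) (tr : tree) (a : addr) (g : goal)
  (A : atom) (rest : list lit) : Prop :=
  single_child tr a (Goal (gcon g) rest) \/
  (exists C'', lt (Goal (gcon g) [Pos A]) C'' /\ satisfiable (CAnd (CNot C'') (gcon g)) /\
     single_child tr a (Goal (CAnd (CNot C'') (gcon g)) rest)) \/
  (leaf tr a /\ exists C'', lt (Goal (gcon g) [Pos A]) C'' /\
     ~ satisfiable (CAnd (CNot C'') (gcon g))).

Definition is_tree
  (negc : tree -> addr -> goal -> atom -> list lit -> Prop) (G : goal) (tr : tree) : Prop :=
  tlab tr [] = Some G /\
  (forall i a g, tlab tr (i :: a) = Some g -> exists g0, tlab tr a = Some g0) /\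
  (forall a g, tlab tr a = Some g ->
     (glits g = [] -> leaf tr a) /\
     (glits g <> [] ->
        tsel tr a < length (glits g) /\
        forall l, nth_error (glits g) (tsel tr a) = Some l ->
          match l with
          | Pos _ => atom_children tr a g (tsel tr a)
          | Neg A => negc tr a g A (firstn (tsel tr a) (glits g) ++ skipn (S (tsel tr a)) (glits g))
          end)).

Definition successful (tr : tree) (a : addr) : Prop :=
  exists g, tlab tr a = Some g /\ glits g = [].

Definition answer (tr : tree) (G : goal) (C : cform) : Prop :=
  exists cs : list cform,
    (forall c, In c cs -> exists a g, tlab tr a = Some g /\ glits g = [] /\ gcon g = c) /\
    C = restrict (disj cs) (fvg G).

Definition cross_section (tr : tree) (S : addr -> Prop) : Prop :=
  (forall a, S a -> tlab tr a <> None) /\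
  (forall a, successful tr a -> exists b c, a = c ++ b /\ S b).

Definition nanswer (tr : tree) (G : goal) (C : cform) : Prop :=
  exists S, cross_section tr S /\
    let NC := fun c => exists a g, S a /\ tlab tr a = Some g /\ gcon g = c in
    ((exists cs, (forall c, In c cs <-> NC c) /\
        C = conj (map (fun c => CNot (restrict c (fvg G))) cs)) \/
     ((~ exists cs, forall c, In c cs <-> NC c) /\ Constr C /\
        (forall x, In x (fvc C) -> In x (fvg G)) /\
        (forall c, NC c -> entails C (CNot (restrict c (fvg G)))))).

(* low k = (answers of t-trees of rank < k, negative answers of tu-trees of rank < k) *)
Fixpoint low (k : ord) : (goal -> cform -> Prop) * (goal -> cform -> Prop) :=
  match k with
  | OZ => (fun _ _ => False, fun _ _ => False)
  | OS k' =>
      (fun G C => fst (low k') G C \/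
                  exists tr, is_tree (t_neg (snd (low k'))) G tr /\ answer tr G C,
       fun G C => snd (low k') G C \/
                  exists tr, is_tree (tu_neg (fst (low k'))) G tr /\ nanswer tr G C)
  | OL f => (fun G C => exists n, fst (low (f n)) G C,
             fun G C => exists n, snd (low (f n)) G C)
  end.

Definition t_tree (k : ord) (G : goal) (tr : tree) : Prop := is_tree (t_neg (snd (low k))) G tr.
Definition tu_tree (k : ord) (G : goal) (tr : tree) : Prop := is_tree (tu_neg (fst (low k))) G tr.

End Hybrid.

(* Main.v *)
(* Both claims are proved together by induction on the rank
   ([tree_answers_sound]), since the trees of rank k use answers of lower rank.
   - Claim (1).  A satisfied answer is satisfied through a successful leaf;
     its assignment is replaced by a ground substitution extending theta
     ([leaf_ground_instance]: the only use of the Herbrand / witness / safety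
     hypothesis).  Walking up the branch, every literal becomes true in
     I_(k+1): a resolved atom by the ground instance of the rule used, which is
     a clause of P/M0, a negative literal by claim (2) at lower rank.
   - Claim (2).  If no literal of G theta were false in I_(k+1), all would be
     [Derivable] in the least model giving the negative part of I_(k+1).
     Replaying that derivation down the tu-tree with fresh rule variants keeps
     every constraint satisfied until the cross-section is met, contradicting
     the negative answer ([derivable_unreachable]). *)

Require Import Defs.
From Stdlib Require Import List Arith Lia Classical ClassicalEpsilon.
Import ListNotations.

Arguments Var {F}. Arguments App {F}.
Arguments CEq {F PC}. Arguments CAt {F PC}. Arguments CNot {F PC}.
Arguments CAnd {F PC}. Arguments COr {F PC}. Arguments CEx {F PC}.
Arguments RA {F PR}. Arguments Pos {F PR}. Arguments Neg {F PR}.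
Arguments Rule {F PR PC}. Arguments rhead {F PR PC}. Arguments rcon {F PR PC}.
Arguments rbody {F PR PC}. Arguments Goal {F PR PC}. Arguments gcon {F PR PC}.
Arguments glits {F PR PC}.
Arguments fvt {F}. Arguments fvts {F}. Arguments wft {F}. Arguments gwft {F}.
Arguments tsubst {F}. Arguments tren {F}.
Arguments fvc {F PC}. Arguments varsc {F PC}. Arguments wfc {F PC}. Arguments cren {F PC}.
Arguments fva {F PR}. Arguments wfa {F PR}. Arguments asubst {F PR}. Arguments gwfa {F PR}.
Arguments litatom {F PR}. Arguments fvl {F PR}. Arguments wfl {F PR}. Arguments lsubst {F PR}.
Arguments ren_rule {F PR PC}. Arguments rule_vars {F PR PC}. Arguments wf_rule {F PR PC}.
Arguments variant {F PR PC}. Arguments fvg {F PR PC}. Arguments goal_vars {F PR PC}.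
Arguments CTrue {F PC}. Arguments CFalse {F PC}. Arguments disj {F PC}. Arguments conj {F PC}.
Arguments eqs {F PC}. Arguments restrict {F PC}.
Arguments dom {F PC}. Arguments fn {F PC}. Arguments pr {F PC}. Arguments eval {F PC}.
Arguments upd {F PC}. Arguments sat {F PC}. Arguments geval {F PC}. Arguments sat_inst {F PC}.
Arguments model {F PC}. Arguments entails {F PC}. Arguments satisfiable {F PC}.
Arguments CET {F PC}. Arguments constraint_language {F PC}. Arguments theory_ok {F PC}.
Arguments hybrid_program {F PR PC}. Arguments goal_ok {F PR PC}. Arguments herbrand {F PC}.
Arguments witness_property {F PC}. Arguments bound_to {F PC}. Arguments safe_rule {F PR PC}.
Arguments safe_program {F PR PC}. Arguments ground_prog {F PR PC}. Arguments lhm {F PR}.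
Arguments Psi {F PR}. Arguments psi_up {F PR}. Arguments lit_false {F PR}.
Arguments true3 {F PR}. Arguments false3 {F PR}. Arguments derives {F PR PC}.
Arguments tlab {F PR PC}. Arguments tsel {F PR PC}. Arguments on_path {F PR PC}.
Arguments leaf {F PR PC}. Arguments single_child {F PR PC}. Arguments atom_children {F PR PC}.
Arguments t_neg {F PR PC}. Arguments tu_neg {F PR PC}. Arguments is_tree {F PR PC}.
Arguments successful {F PR PC}. Arguments answer {F PR PC}. Arguments cross_section {F PR PC}.
Arguments nanswer {F PR PC}. Arguments low {F PR PC}. Arguments t_tree {F PR PC}.
Arguments tu_tree {F PR PC}.

Lemma in_le_list_max l x : In x l -> x <= list_max l.
Proof.
  intros H. pose proof (proj1 (list_max_le l (list_max l)) (le_n _)) as Hf.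
  rewrite Forall_forall in Hf. auto.
Qed.

Lemma in_firstn {A} n (l : list A) x : In x (firstn n l) -> In x l.
Proof. intros H. rewrite <- (firstn_skipn n l). apply in_or_app; auto. Qed.

Lemma in_skipn {A} n (l : list A) x : In x (skipn n l) -> In x l.
Proof. intros H. rewrite <- (firstn_skipn n l). apply in_or_app; auto. Qed.

Lemma in_around {A} (L : list A) n l : In l (firstn n L ++ skipn (S n) L) -> In l L.
Proof. intros H. apply in_app_iff in H as [H|H]. eapply in_firstn; eauto. eapply in_skipn; eauto. Qed.

Lemma in_around_mid {A} (L X : list A) n l : In l (firstn n L ++ skipn (S n) L) ->
  In l (firstn n L ++ X ++ skipn (S n) L).
Proof. rewrite !in_app_iff. tauto. Qed.

Lemma in_split_at {A} (L : list A) n l0 l : nth_error L n = Some l0 -> In l L ->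
  l = l0 \/ In l (firstn n L ++ skipn (S n) L).
Proof.
  intros Hn Hl. rewrite <- (firstn_skipn_middle n L Hn) in Hl.
  apply in_app_iff in Hl as [Hl|[Hl|Hl]]; auto; right; apply in_app_iff; auto.
Qed.

Section Syntax.
Variables (F PR : Type) (arF : F -> nat) (arR : PR -> nat).
Implicit Types (s : nat -> term F) (a : atom F PR) (l : lit F PR).

Lemma term_ind' (Pt : term F -> Prop)
  (HV : forall x, Pt (Var x))
  (HA : forall f ts, Forall Pt ts -> Pt (App f ts)) : forall t, Pt t.
Proof.
  fix IH 1. intros [x|f ts]. apply HV. apply HA.
  induction ts as [|u ts IHts]; constructor. apply IH. exact IHts.
Qed.

Lemma fvt_App (f : F) (ts : list (term F)) : fvt (App f ts) = flat_map fvt ts.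
Proof. simpl. induction ts; simpl; congruence. Qed.

Lemma wft_App (f : F) (ts : list (term F)) :
  wft arF (App f ts) <-> length ts = arF f /\ Forall (wft arF) ts.
Proof.
  simpl. split; intros [H1 H2]; split; auto; clear H1; induction ts; simpl in *; auto.
  - destruct H2; constructor; auto.
  - inversion H2; subst; split; auto. match goal with H: Forall _ ts |- _ => exact (IHts H) end.
Qed.

Lemma tsubst_tsubst s s' t : tsubst s (tsubst s' t) = tsubst (fun x => tsubst s (s' x)) t.
Proof.
  induction t using term_ind'; simpl; auto.
  f_equal. rewrite map_map. apply map_ext_Forall. eapply Forall_impl; [|exact H]. auto.
Qed.

Lemma tsubst_ext s s' t : (forall x, In x (fvt t) -> s x = s' x) -> tsubst s t = tsubst s' t.
Proof.
  induction t using term_ind'; intros Hx; simpl; auto.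
  - apply Hx; simpl; auto.
  - f_equal. rewrite fvt_App in Hx. induction H; simpl; auto.
    simpl in Hx. f_equal; auto.
    + apply H; intros; apply Hx; apply in_or_app; auto.
    + apply IHForall; intros; apply Hx; apply in_or_app; auto.
Qed.

Lemma fvt_tsubst s t y : In y (fvt (tsubst s t)) <-> exists x, In x (fvt t) /\ In y (fvt (s x)).
Proof.
  induction t using term_ind'.
  - simpl. split; [intros; exists x; auto | intros [x' [[->|[]] H]]; auto].
  - simpl tsubst. rewrite !fvt_App, !flat_map_concat_map, map_map. split.
    + intros Hy. apply in_concat in Hy as [l [Hl Hy]]. apply in_map_iff in Hl as [t [<- Ht]].
      rewrite Forall_forall in H. apply H in Hy as [x [Hx1 Hx2]]; auto.
      exists x; split; auto. apply in_concat. exists (fvt t); split; auto. apply in_map; auto.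
    + intros [x [Hx1 Hx2]]. apply in_concat in Hx1 as [l [Hl Hx]].
      apply in_map_iff in Hl as [t [<- Ht]]. apply in_concat. exists (fvt (tsubst s t)).
      split. apply in_map_iff; eauto. rewrite Forall_forall in H. apply H; eauto.
Qed.

Lemma wft_tsubst s t : wft arF t -> (forall x, In x (fvt t) -> wft arF (s x)) -> wft arF (tsubst s t).
Proof.
  induction t using term_ind'; intros Ht Hs.
  - apply Hs; simpl; auto.
  - simpl tsubst. apply wft_App in Ht as [Hl Hf]. apply wft_App. split.
    + rewrite length_map; auto.
    + rewrite Forall_forall in *. intros u Hu. apply in_map_iff in Hu as [t [<- Ht]].
      apply H; auto. intros; apply Hs. rewrite fvt_App. apply in_flat_map; eauto.
Qed.

Lemma gwft_tsubst s t : wft arF t -> (forall x, In x (fvt t) -> gwft arF (s x)) -> gwft arF (tsubst s t).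
Proof.
  intros Ht Hs. split.
  - apply wft_tsubst; auto. intros; apply Hs; auto.
  - destruct (fvt (tsubst s t)) as [|y l] eqn:E; auto. exfalso.
    assert (In y (fvt (tsubst s t))) by (rewrite E; simpl; auto).
    apply fvt_tsubst in H as [x [Hx Hy]]. destruct (Hs x Hx) as [_ Hg]. rewrite Hg in Hy. inversion Hy.
Qed.

Lemma fvt_tren pi (t : term F) : fvt (tren pi t) = map pi (fvt t).
Proof.
  unfold tren. induction t using term_ind'; auto.
  simpl tsubst. rewrite !fvt_App, !flat_map_concat_map, map_map, concat_map, map_map.
  f_equal. apply map_ext_Forall. eapply Forall_impl; [|exact H]. auto.
Qed.

Lemma fvts_map_tsubst s ts y :
  In y (fvts (map (tsubst s) ts)) <-> exists x, In x (fvts ts) /\ In y (fvt (s x)).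
Proof.
  unfold fvts. rewrite in_flat_map. split.
  - intros [t [Ht Hy]]. apply in_map_iff in Ht as [t' [<- Ht']]. apply fvt_tsubst in Hy as [x [? ?]].
    exists x. split; auto. apply in_flat_map; eauto.
  - intros [x [Hx Hy]]. apply in_flat_map in Hx as [t [Ht Hx]]. exists (tsubst s t). split.
    apply in_map; auto. apply fvt_tsubst; eauto.
Qed.

Lemma asubst_asubst s s' a : asubst s (asubst s' a) = asubst (fun x => tsubst s (s' x)) a.
Proof. destruct a; simpl. f_equal. rewrite map_map. apply map_ext. intros; apply tsubst_tsubst. Qed.

Lemma lsubst_lsubst s s' l : lsubst s (lsubst s' l) = lsubst (fun x => tsubst s (s' x)) l.
Proof. destruct l; simpl; f_equal; apply asubst_asubst. Qed.

Lemma asubst_ext s s' a : (forall x, In x (fva a) -> s x = s' x) -> asubst s a = asubst s' a.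
Proof.
  destruct a as [p ts]; simpl; intros H. f_equal. apply map_ext_in. intros t Ht.
  apply tsubst_ext. intros x Hx; apply H. unfold fvts. apply in_flat_map; eauto.
Qed.

Lemma lsubst_ext s s' l : (forall x, In x (fvl l) -> s x = s' x) -> lsubst s l = lsubst s' l.
Proof. destruct l; unfold fvl; simpl; intros; f_equal; apply asubst_ext; auto. Qed.

Lemma fva_asubst s a y : In y (fva (asubst s a)) <-> exists x, In x (fva a) /\ In y (fvt (s x)).
Proof. destruct a; simpl. apply fvts_map_tsubst. Qed.

Lemma fva_ren pi a y : In y (fva (asubst (fun x => Var (pi x)) a)) <-> exists x, In x (fva a) /\ y = pi x.
Proof.
  rewrite fva_asubst. simpl. split; intros [x [H1 H2]]; exists x; split; auto.
  destruct H2 as [<-|[]]; auto.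
Qed.

Lemma fvl_ren pi l y : In y (fvl (lsubst (fun x => Var (pi x)) l)) <-> exists x, In x (fvl l) /\ y = pi x.
Proof. destruct l; unfold fvl; simpl; apply fva_ren. Qed.

Lemma wfa_asubst s a : wfa arF arR a -> (forall x, In x (fva a) -> wft arF (s x)) ->
  wfa arF arR (asubst s a).
Proof.
  destruct a as [p ts]; simpl. intros [Hl Hf] Hs. split. rewrite length_map; auto.
  rewrite Forall_forall in *. intros u Hu. apply in_map_iff in Hu as [t [<- Ht]].
  apply wft_tsubst; auto. intros x Hx. apply Hs. unfold fvts. apply in_flat_map; eauto.
Qed.

Lemma wfa_ren pi a : wfa arF arR a -> wfa arF arR (asubst (fun x => Var (pi x)) a).
Proof. intros H; apply wfa_asubst; simpl; auto. Qed.

Lemma wfl_ren pi l : wfl arF arR l -> wfl arF arR (lsubst (fun x => Var (pi x)) l).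
Proof. destruct l; apply wfa_ren. Qed.

Lemma gwfa_asubst s a : wfa arF arR a -> (forall x, In x (fva a) -> gwft arF (s x)) ->
  gwfa arF arR (asubst s a).
Proof.
  intros Hw Hs. split. apply wfa_asubst; auto. intros x Hx; apply Hs; auto.
  destruct (fva (asubst s a)) as [|y ys] eqn:E; auto. exfalso.
  assert (Hy : In y (fva (asubst s a))) by (rewrite E; simpl; auto).
  apply fva_asubst in Hy as [x [Hx Hy]]. destruct (Hs x Hx) as [_ Hg]. rewrite Hg in Hy. inversion Hy.
Qed.

End Syntax.

Section TermSemantics.
Variables (F PC : Type) (arF : F -> nat) (c0 : F) (M : structure F PC).

Lemma eval_tsubst a (s : nat -> term F) t :
  eval M a (tsubst s t) = eval M (fun x => eval M a (s x)) t.
Proof.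
  induction t using term_ind'; auto.
  simpl. rewrite map_map. f_equal. apply map_ext_Forall.
  eapply Forall_impl; [|exact H]. auto.
Qed.

Lemma eval_ext a b (t : term F) : (forall x, In x (fvt t) -> a x = b x) -> eval M a t = eval M b t.
Proof.
  induction t using term_ind'; intros Hx.
  - apply Hx; simpl; auto.
  - simpl eval. f_equal. rewrite fvt_App in Hx. induction H; simpl; auto.
    f_equal.
    + apply H; intros; apply Hx; simpl; apply in_or_app; auto.
    + apply IHForall; intros; apply Hx; simpl; apply in_or_app; auto.
Qed.

Lemma eval_ground a (t : term F) : fvt t = [] -> eval M a t = geval c0 M t.
Proof. intros H. apply eval_ext. rewrite H. intros _ []. Qed.

Lemma geval_tsubst (s : nat -> term F) t :
  geval c0 M (tsubst s t) = eval M (fun x => geval c0 M (s x)) t.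
Proof. unfold geval. apply eval_tsubst. Qed.

Lemma in_map2_eval a b (ts us : list (term F)) t :
  map (eval M a) ts = map (eval M b) us -> In t ts -> exists u, In u us /\ eval M a t = eval M b u.
Proof.
  revert us; induction ts as [|t' ts IH]; intros [|u us] H Hin; simpl in *;
    try discriminate; try contradiction.
  injection H as H1 H2. destruct Hin as [<-|Hin]; eauto.
  destruct (IH us H2 Hin) as [u' [? ?]]; eauto.
Qed.

Hypothesis HCET : CET arF M.

Lemma cet_inj a (t u : term F) : gwft arF t -> gwft arF u -> eval M a t = eval M a u -> t = u.
Proof.
  revert u. induction t as [x|f ts IH] using term_ind'; intros u Ht Hu He.
  - destruct Ht as [_ Ht]. discriminate.
  - destruct u as [y|g us]. { destruct Hu as [_ Hu]. discriminate. }
    destruct Ht as [Ht Htg]. destruct Hu as [Hu Hug].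
    apply wft_App in Ht as [Htl Htf]. apply wft_App in Hu as [Hul Huf].
    simpl eval in He. destruct HCET as [C1 [C2 _]].
    destruct (classic (f = g)) as [<-|Hfg].
    2:{ exfalso. eapply C2; [exact Hfg| | |exact He]; rewrite length_map; auto. }
    apply C1 in He; try (rewrite length_map; auto). f_equal.
    rewrite fvt_App in Htg, Hug.
    clear Htl Hul. revert us Huf Hug He. induction ts as [|t ts IHts]; intros [|u us] Huf Hug He;
      simpl in *; try discriminate; auto.
    injection He as He1 He2. inversion IH; subst. inversion Htf; subst. inversion Huf; subst.
    apply app_eq_nil in Htg as [Hg1 Hg2]. apply app_eq_nil in Hug as [Hg3 Hg4].
    f_equal.
    + apply H1; try split; auto.
    + apply IHts; auto.
Qed.

Lemma map_geval_inj (xs ys : list (term F)) : Forall (gwft arF) xs -> Forall (gwft arF) ys ->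
  map (geval c0 M) xs = map (geval c0 M) ys -> xs = ys.
Proof.
  revert ys; induction xs as [|x xs IH]; intros [|y ys] Hx Hy H; simpl in *; try discriminate; auto.
  injection H as H1 H2. inversion Hx; inversion Hy; subst. f_equal; auto.
  eapply cet_inj; eauto.
Qed.

Definition denoted (a0 : nat -> dom M) (x : nat) : Prop :=
  exists u, gwft arF u /\ a0 x = eval M a0 u.

Lemma cet_decomp a (t u : term F) y : wft arF t -> gwft arF u -> eval M a t = eval M a u ->
  In y (fvt t) -> denoted a y.
Proof.
  revert u. induction t as [x|f ts IH] using term_ind'; intros u Ht Hu He Hy.
  - simpl in Hy. destruct Hy as [<-|[]]. exists u; split; auto.
  - destruct u as [z|g us]. { destruct Hu as [_ Hu]. discriminate. }
    destruct Hu as [Hu Hug].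
    apply wft_App in Ht as [Htl Htf]. apply wft_App in Hu as [Hul Huf].
    simpl eval in He. destruct HCET as [C1 [C2 _]].
    destruct (classic (f = g)) as [<-|Hfg].
    2:{ exfalso. eapply C2; [exact Hfg| | |exact He]; rewrite length_map; auto. }
    apply C1 in He; try (rewrite length_map; auto).
    rewrite fvt_App in Hy. apply in_flat_map in Hy as [t [Ht Hy]].
    destruct (in_map2_eval a a ts us t He Ht) as [u [Hu1 Hu2]].
    rewrite Forall_forall in IH, Htf, Huf. eapply IH; eauto.
    split; auto. rewrite fvt_App in Hug. destruct (fvt u) eqn:E; auto.
    assert (In n (flat_map fvt us)) by (apply in_flat_map; exists u; rewrite E; simpl; auto).
    rewrite Hug in H; inversion H.
Qed.

Lemma ground_value a (t : term F) : wft arF t -> (forall y, In y (fvt t) -> denoted a y) ->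
  exists u, gwft arF u /\ eval M a t = eval M a u.
Proof.
  intros Ht Hy.
  assert (Hs : forall y, exists u, (In y (fvt t) -> gwft arF u /\ a y = eval M a u)).
  { intros y. destruct (classic (In y (fvt t))) as [Hin|Hn].
    - destruct (Hy y Hin) as [u Hu]; eauto.
    - exists (Var 0). tauto. }
  apply choice in Hs as [s Hs].
  exists (tsubst s t). split.
  - apply gwft_tsubst; auto. intros x Hx. apply Hs; auto.
  - rewrite eval_tsubst. apply eval_ext. intros x Hx. apply Hs; auto.
Qed.

Lemma denoted_eq a (t u : term F) y : wft arF t -> wft arF u ->
  (forall z, In z (fvt u) -> denoted a z) -> eval M a t = eval M a u -> In y (fvt t) -> denoted a y.
Proof.
  intros Ht Hu Hd He Hy. destruct (ground_value a u Hu Hd) as [u' [Hu' Huu']].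
  eapply cet_decomp; [exact Ht | exact Hu' | | exact Hy]. congruence.
Qed.

End TermSemantics.
Arguments denoted {F PC} arF M a0 x.

Section ConstraintSemantics.
Variables (F PC : Type) (c0 : F).
Implicit Types (M : structure F PC) (c d : cform F PC).

Lemma sat_ext M a b c : (forall x, In x (fvc c) -> a x = b x) -> (sat M a c <-> sat M b c).
Proof.
  revert a b; induction c; intros a b Hx; simpl in *.
  - rewrite (eval_ext _ _ M a b t), (eval_ext _ _ M a b u); try tauto;
      intros; apply Hx; apply in_or_app; auto.
  - replace (map (eval M a) ts) with (map (eval M b) ts); [tauto|].
    apply map_ext_in. intros t Ht. symmetry. apply eval_ext. intros; apply Hx.
    unfold fvts. apply in_flat_map; eauto.
  - rewrite (IHc a b); tauto.
  - rewrite (IHc1 a b), (IHc2 a b); try tauto; intros; apply Hx; apply in_or_app; auto.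
  - rewrite (IHc1 a b), (IHc2 a b); try tauto; intros; apply Hx; apply in_or_app; auto.
  - split; intros [dd H]; exists dd; revert H; apply IHc; intros y Hy; unfold upd;
      destruct (Nat.eqb y x) eqn:E; auto; first [apply Hx | symmetry; apply Hx];
      apply filter_In; rewrite E; auto.
Qed.

Lemma fvc_varsc c x : In x (fvc c) -> In x (varsc c).
Proof.
  induction c; simpl; auto; try (rewrite !in_app_iff; tauto).
  intros H. apply filter_In in H as [H _]. auto.
Qed.

Lemma sat_cren M a pi c : (forall x y, pi x = pi y -> x = y) ->
  (sat M a (cren pi c) <-> sat M (fun x => a (pi x)) c).
Proof.
  intros Hpi. revert a; induction c; intros a; simpl.
  - unfold tren. rewrite !eval_tsubst. simpl. tauto.
  - rewrite map_map. replace (map (fun x => eval M a (tren pi x)) ts)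
      with (map (eval M (fun x => a (pi x))) ts); [tauto|].
    apply map_ext. intros t. unfold tren. rewrite eval_tsubst. reflexivity.
  - rewrite IHc; tauto.
  - rewrite IHc1, IHc2; tauto.
  - rewrite IHc1, IHc2; tauto.
  - split; intros [dd H]; exists dd; revert H; rewrite IHc; apply sat_ext; intros y _;
      unfold upd; destruct (Nat.eqb y x) eqn:E; destruct (Nat.eqb (pi y) (pi x)) eqn:E2; auto;
      apply Nat.eqb_eq in E || apply Nat.eqb_eq in E2; subst;
      try (rewrite Nat.eqb_refl in *; discriminate);
      apply Hpi in E2; subst; rewrite Nat.eqb_refl in E; discriminate.
Qed.

Lemma varsc_cren pi c : varsc (cren pi c) = map pi (varsc c).
Proof.
  induction c; simpl; rewrite ?map_app; try congruence.
  - rewrite !fvt_tren. reflexivity.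
  - unfold fvts. rewrite flat_map_concat_map, flat_map_concat_map, concat_map, !map_map.
    f_equal. apply map_ext. apply fvt_tren.
Qed.

Lemma fvc_cren pi c y : (forall x y, pi x = pi y -> x = y) ->
  (In y (fvc (cren pi c)) <-> exists x, In x (fvc c) /\ y = pi x).
Proof.
  intros Hpi. revert y; induction c; intros y; simpl.
  - rewrite !in_app_iff, !fvt_tren, !in_map_iff. split.
    + intros [[x [<- H]]|[x [<- H]]]; exists x; rewrite in_app_iff; auto.
    + intros [x [H ->]]. apply in_app_iff in H as [H|H]; eauto.
  - unfold fvts. rewrite !in_flat_map. split.
    + intros [t [Ht Hy]]. apply in_map_iff in Ht as [t' [<- Ht']].
      rewrite fvt_tren in Hy. apply in_map_iff in Hy as [x [<- Hx]].
      exists x; split; auto; apply in_flat_map; eauto.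
    + intros [x [Hx0 ->]]. apply in_flat_map in Hx0 as [t [Ht Hx]].
      exists (tren pi t). split. apply in_map; auto. rewrite fvt_tren. apply in_map; auto.
  - apply IHc.
  - rewrite !in_app_iff, IHc1, IHc2. split.
    + intros [[x [H ->]]|[x [H ->]]]; exists x; rewrite in_app_iff; auto.
    + intros [x [H ->]]. apply in_app_iff in H as [H|H]; eauto.
  - rewrite !in_app_iff, IHc1, IHc2. split.
    + intros [[x [H ->]]|[x [H ->]]]; exists x; rewrite in_app_iff; auto.
    + intros [x [H ->]]. apply in_app_iff in H as [H|H]; eauto.
  - rewrite filter_In, IHc. split.
    + intros [[x' [H1 ->]] H2]. exists x'. split; auto. apply filter_In. split; auto.
      destruct (Nat.eqb x' x) eqn:E; auto. apply Nat.eqb_eq in E; subst.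
      rewrite Nat.eqb_refl in H2. auto.
    + intros [x' [H1 ->]]. apply filter_In in H1 as [H1 H2]. split; eauto.
      destruct (Nat.eqb (pi x') (pi x)) eqn:E; auto. apply Nat.eqb_eq, Hpi in E; subst.
      rewrite Nat.eqb_refl in H2; auto.
Qed.

Lemma fvc_foldex c xs y : In y (fvc (fold_right CEx c xs)) <-> In y (fvc c) /\ ~ In y xs.
Proof.
  induction xs as [|x xs IH]; simpl. tauto.
  rewrite filter_In, IH. destruct (Nat.eqb y x) eqn:E.
  - apply Nat.eqb_eq in E; subst. simpl. split; [intros [_ H]; discriminate | intros [_ H]; exfalso; auto].
  - apply Nat.eqb_neq in E. simpl. split; [intros [[H1 H2] _]; split; [|intros [->|]]; auto
                                         | intros [H1 H2]; repeat split; auto].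
Qed.

Lemma sat_foldex M b c xs : sat M b (fold_right CEx c xs) <->
  exists a, (forall x, ~ In x xs -> a x = b x) /\ sat M a c.
Proof.
  revert b; induction xs as [|x xs IH]; intros b; simpl.
  - split. intros H; exists b; auto. intros [a [Ha H]]. revert H. apply sat_ext. intros; symmetry; auto.
  - split.
    + intros [dd H]. apply IH in H as [a [Ha H]]. exists a. split; auto.
      intros y Hy. rewrite Ha by tauto. unfold upd. destruct (Nat.eqb y x) eqn:E; auto.
      apply Nat.eqb_eq in E; subst; tauto.
    + intros [a [Ha H]]. exists (a x). apply IH. exists a. split; auto.
      intros y Hy. unfold upd. destruct (Nat.eqb y x) eqn:E.
      * apply Nat.eqb_eq in E; subst; auto.
      * apply Nat.eqb_neq in E. apply Ha. intros [|]; auto.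
Qed.

Lemma fvc_restrict c V x : In x (fvc (restrict c V)) -> In x V.
Proof.
  unfold restrict. rewrite fvc_foldex, filter_In. intros [H1 H2].
  destruct (existsb (Nat.eqb x) V) eqn:E.
  - apply existsb_exists in E as [y [Hy E]]. apply Nat.eqb_eq in E; subst; auto.
  - exfalso; apply H2; split; auto.
Qed.

Lemma sat_restrict M b c V : sat M b (restrict c V) <->
  exists a, (forall x, In x V -> a x = b x) /\ sat M a c.
Proof.
  unfold restrict. rewrite sat_foldex. split.
  - intros [a [Ha H]]. exists a. split; auto. intros x Hx. apply Ha.
    rewrite filter_In. intros [_ E]. assert (existsb (Nat.eqb x) V = true).
    { apply existsb_exists. exists x; split; auto. apply Nat.eqb_refl. }
    rewrite H0 in E. discriminate.
  - intros [a [Ha H]].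
    exists (fun y => if in_dec Nat.eq_dec y (filter (fun x => negb (existsb (Nat.eqb x) V)) (fvc c))
             then a y else b y).
    split.
    + intros x Hx. destruct (in_dec _ _ _); tauto.
    + revert H. apply sat_ext. intros y Hy. destruct (in_dec _ _ _); auto.
      symmetry. apply Ha. destruct (existsb (Nat.eqb y) V) eqn:E.
      * apply existsb_exists in E as [z [Hz E]]. apply Nat.eqb_eq in E; subst; auto.
      * exfalso. apply n. apply filter_In. rewrite E. auto.
Qed.

Lemma sat_conj M a cs : sat M a (conj c0 cs) <-> (forall c, In c cs -> sat M a c).
Proof.
  induction cs as [|c cs IH]. { simpl. split. intros _ _ []. intros _; reflexivity. }
  destruct cs as [|c' cs].
  - simpl. split. intros H d [<-|[]]; auto. auto.
  - change (conj c0 (c :: c' :: cs)) with (CAnd c (conj c0 (c' :: cs))). simpl sat at 1. rewrite IH.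
    split; [intros [H1 H2] d [<-|Hd]; auto | intros H; split; intros; apply H; simpl; auto].
Qed.

Lemma sat_disj M a cs : sat M a (disj c0 cs) <-> (exists c, In c cs /\ sat M a c).
Proof.
  induction cs as [|c cs IH].
  { simpl. split. intros H; exfalso; apply H; reflexivity. intros [? [[] _]]. }
  destruct cs as [|c' cs].
  - simpl. split. intros H; eauto. intros [d [[<-|[]] H]]; auto.
  - change (disj c0 (c :: c' :: cs)) with (COr c (disj c0 (c' :: cs))). simpl sat at 1. rewrite IH.
    split.
    + intros [H|[d [Hd H]]]; [exists c | exists d]; simpl; auto.
    + intros [d [[<-|Hd] H]]; auto. right; eauto.
Qed.

Lemma fvc_conj cs x : In x (fvc (conj c0 cs)) -> exists c, In c cs /\ In x (fvc c).
Proof.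
  induction cs as [|c cs IH]; simpl. intros [].
  destruct cs as [|c' cs]. intros; exists c; simpl; auto.
  change (conj c0 (c :: c' :: cs)) with (CAnd c (conj c0 (c' :: cs))). simpl fvc at 1.
  rewrite in_app_iff. intros [H|H]. exists c; auto. destruct (IH H) as [d [? ?]]; eauto.
Qed.

Lemma sat_eqs M a ts us : length ts = length us ->
  (sat M a (eqs c0 ts us) <-> map (eval M a) ts = map (eval M a) us).
Proof.
  intros Hl. unfold eqs. rewrite sat_conj. revert us Hl; induction ts as [|t ts IH]; intros [|u us] Hl;
    simpl in *; try discriminate.
  - split; auto. intros _ _ [].
  - injection Hl as Hl. split.
    + intros H. f_equal. apply (H (CEq t u)); auto. apply IH; auto.
    + intros H. injection H as H1 H2. intros c [<-|Hc]; simpl; auto. apply (proj2 (IH us Hl) H2); auto.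
Qed.

Lemma fvc_eqs ts us x : In x (fvc (PC:=PC) (eqs c0 ts us)) -> In x (fvts ts) \/ In x (fvts us).
Proof.
  unfold eqs. intros H. apply fvc_conj in H as [c [Hc Hx]]. apply in_map_iff in Hc as [[t u] [<- Hp]].
  simpl in Hx. unfold fvts. rewrite !in_flat_map. apply in_app_iff in Hx as [Hx|Hx].
  - left. exists t. split; auto. apply in_combine_l in Hp; auto.
  - right. exists u. split; auto. apply in_combine_r in Hp; auto.
Qed.

End ConstraintSemantics.

(** * The operator Psi: monotonicity, and derivability in least models *)

Section PsiFacts.
Variables (F PR : Type) (arF : F -> nat) (arR : PR -> nat).
Variable Q : atom F PR -> list (lit F PR) -> Prop.

Lemma lhm_mono (N N' : atom F PR -> Prop) a :
  (forall b, N b -> N' b) -> lhm Q N a -> lhm Q N' a.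
Proof.
  intros HN H. induction H as [h ls HQ Hp IH Hn]. apply lhm_rule with ls; auto.
Qed.

Lemma Psi_mono (I I' : interp F PR) l :
  (forall l, I l -> I' l) -> Psi arF arR Q I l -> Psi arF arR Q I' l.
Proof.
  intros HI. destruct l as [a|a]; simpl.
  - apply lhm_mono. intros b; apply HI.
  - intros [Hg Hn]. split; auto. intros H. apply Hn. revert H. apply lhm_mono.
    intros b [Hb Hb']. split; auto.
Qed.

Lemma psi_step k l : psi_up arF arR Q k l -> psi_up arF arR Q (OS k) l.
Proof.
  revert l. induction k as [|k IH|f IH]; intros l H; simpl in *.
  - contradiction.
  - revert H. apply Psi_mono. apply IH.
  - destruct H as [n H]. apply IH in H. simpl in H. revert H. apply Psi_mono.
    intros l' H'. exists n; auto.
Qed.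

(* This is the
   "goal-directed" view of the least model lhm Q N, suited to replaying a
   derivation along the branches of a tree. *)
Variable N : atom F PR -> Prop.

Inductive Derivable : list (lit F PR) -> Prop :=
| derivable : forall L,
    (forall i b, nth_error L i = Some (Neg b) ->
       N b /\ Derivable (firstn i L ++ skipn (S i) L)) ->
    (forall i a, nth_error L i = Some (Pos a) ->
       exists ls, Q a ls /\ Derivable (firstn i L ++ ls ++ skipn (S i) L)) ->
    Derivable L.

Lemma Derivable_ind' (PP : list (lit F PR) -> Prop)
  (HH : forall L,
    (forall i b, nth_error L i = Some (Neg b) -> N b /\ Derivable (firstn i L ++ skipn (S i) L) /\
        PP (firstn i L ++ skipn (S i) L)) ->
    (forall i a, nth_error L i = Some (Pos a) ->
       exists ls, Q a ls /\ Derivable (firstn i L ++ ls ++ skipn (S i) L) /\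
         PP (firstn i L ++ ls ++ skipn (S i) L)) ->
    PP L) : forall L, Derivable L -> PP L.
Proof.
  fix IH 2. intros L [L0 Hn Hp]. apply HH.
  - intros i b Hb. destruct (Hn i b Hb) as [H1 H2]. split; [exact H1|]. split; [exact H2|].
    apply IH; exact H2.
  - intros i a Ha. destruct (Hp i a Ha) as [ls [H1 H2]]. exists ls. split; [exact H1|].
    split; [exact H2|]. apply IH; exact H2.
Qed.

Lemma Derivable_app L1 L2 : Derivable L1 -> Derivable L2 -> Derivable (L1 ++ L2).
Proof.
  intros H1. revert L2. induction H1 as [L1 Hn1 Hp1] using Derivable_ind'. intros L2 H2.
  assert (HG1 : Derivable L1).
  { constructor;
    [ intros i b Hb; destruct (Hn1 i b Hb) as [? [? ?]]; auto
    | intros i a Ha; destruct (Hp1 i a Ha) as [ls [? [? ?]]]; eauto ]. }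
  induction H2 as [L2 Hn2 Hp2] using Derivable_ind'.
  assert (HG2 : Derivable L2).
  { constructor;
    [ intros i b Hb; destruct (Hn2 i b Hb) as [? [? ?]]; auto
    | intros i a Ha; destruct (Hp2 i a Ha) as [ls [? [? ?]]]; eauto ]. }
  constructor.
  - intros i b Hb. destruct (Nat.lt_ge_cases i (length L1)) as [Hi|Hi].
    + rewrite nth_error_app1 in Hb by auto. destruct (Hn1 i b Hb) as [HN [_ HI]].
      split; auto. rewrite firstn_app, skipn_app.
      replace (i - length L1) with 0 by lia. replace (S i - length L1) with 0 by lia.
      rewrite firstn_O, skipn_O, app_nil_r, app_assoc. apply HI; auto.
    + rewrite nth_error_app2 in Hb by auto. destruct (Hn2 _ b Hb) as [HN [_ HI]].
      split; auto. rewrite firstn_app, skipn_app.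
      rewrite firstn_all2 by lia. rewrite skipn_all2 by lia.
      replace (S i - length L1) with (S (i - length L1)) by lia. rewrite <- app_assoc. auto.
  - intros i a Ha. destruct (Nat.lt_ge_cases i (length L1)) as [Hi|Hi].
    + rewrite nth_error_app1 in Ha by auto. destruct (Hp1 i a Ha) as [ls [HQ [_ HI]]].
      exists ls. split; auto. rewrite firstn_app, skipn_app.
      replace (i - length L1) with 0 by lia. replace (S i - length L1) with 0 by lia.
      rewrite firstn_O, skipn_O, app_nil_r, !app_assoc. rewrite <- (app_assoc _ ls). apply HI; auto.
    + rewrite nth_error_app2 in Ha by auto. destruct (Hp2 _ a Ha) as [ls [HQ [_ HI]]].
      exists ls. split; auto. rewrite firstn_app, skipn_app.
      rewrite firstn_all2 by lia. rewrite skipn_all2 by lia.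
      replace (S i - length L1) with (S (i - length L1)) by lia. rewrite <- app_assoc. auto.
Qed.

Lemma Derivable_nil : Derivable [].
Proof. constructor; intros [|i] ? H; discriminate. Qed.

Lemma Derivable_neg b : N b -> Derivable [Neg b].
Proof.
  intros Hb. constructor.
  - intros [|i] b' H; simpl in H; try (destruct i; discriminate).
    injection H as <-. split; auto. apply Derivable_nil.
  - intros [|i] a H; simpl in H; try (destruct i; discriminate). discriminate.
Qed.

Lemma Derivable_pos a ls : Q a ls -> Derivable ls -> Derivable [Pos a].
Proof.
  intros HQ Hls. constructor.
  - intros [|i] b' H; simpl in H; try (destruct i; discriminate). discriminate.
  - intros [|i] a' H; simpl in H; try (destruct i; discriminate).
    injection H as <-. exists ls. split; auto. simpl. rewrite app_nil_r. auto.
Qed.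

Lemma Derivable_list L : (forall l, In l L -> Derivable [l]) -> Derivable L.
Proof.
  induction L as [|l L IH]; intros H. apply Derivable_nil.
  change (l :: L) with ([l] ++ L). apply Derivable_app. apply H; simpl; auto.
  apply IH; intros; apply H; simpl; auto.
Qed.

Lemma lhm_Derivable a : lhm Q N a -> Derivable [Pos a].
Proof.
  intros H. induction H as [h ls HQ Hp IH Hn]. apply Derivable_pos with ls; auto.
  apply Derivable_list. intros [b|b] Hb. apply IH; auto. apply Derivable_neg; auto.
Qed.

End PsiFacts.
Arguments Derivable {F PR} Q N _.

Lemma rule_vars_ren {F PR PC} pi (r : rule F PR PC) y :
  In y (rule_vars (ren_rule pi r)) <-> exists x, In x (rule_vars r) /\ y = pi x.
Proof.
  unfold rule_vars, ren_rule; simpl. rewrite !in_app_iff, fva_ren, varsc_cren, in_map_iff.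
  rewrite !in_flat_map. split.
  - intros [[x [? ?]]|[[x [? ?]]|[l [Hl Hy]]]].
    + exists x. rewrite !in_app_iff. auto.
    + exists x. rewrite !in_app_iff. auto.
    + apply in_map_iff in Hl as [l' [<- Hl']]. apply fvl_ren in Hy as [x [? ?]]. exists x.
      rewrite !in_app_iff, in_flat_map. split; [right; right; eauto | auto].
  - intros [x [Hx ->]]. rewrite !in_app_iff, in_flat_map in Hx. destruct Hx as [Hx|[Hx|[l [Hl Hx]]]].
    + left; eauto.
    + right; left; eauto.
    + right; right. exists (lsubst (fun x => Var (pi x)) l). split. apply in_map; auto.
      apply fvl_ren; eauto.
Qed.

Lemma variant_ren {F PR PC} (r' r : rule F PR PC) : variant r' r ->
  exists pi, (forall x y, pi x = pi y -> x = y) /\ r' = ren_rule pi r.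
Proof. intros [pi [H1 [_ H3]]]; eauto. Qed.

Lemma fresh_perm (Sp : nat -> Prop) (R : list nat) : (exists N, forall x, Sp x -> x < N) ->
  exists pi : nat -> nat, (forall x y, pi x = pi y -> x = y) /\ (forall y, exists x, pi x = y) /\
    (forall x, In x R -> ~ Sp (pi x)).
Proof.
  intros [N HN]. set (K := Nat.max N (S (list_max R))).
  exists (fun x => if x <? K then x + K else if x <? 2 * K then x - K else x). split; [|split].
  - intros x y. destruct (x <? K) eqn:E1; destruct (y <? K) eqn:E2;
      try destruct (x <? 2 * K) eqn:E3; try destruct (y <? 2 * K) eqn:E4;
      rewrite ?Nat.ltb_lt, ?Nat.ltb_ge in *; lia.
  - intros y. destruct (y <? K) eqn:E1.
    + exists (y + K). destruct (y + K <? K) eqn:E2; destruct (y + K <? 2 * K) eqn:E3;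
        rewrite ?Nat.ltb_lt, ?Nat.ltb_ge in *; lia.
    + destruct (y <? 2 * K) eqn:E2.
      * exists (y - K). destruct (y - K <? K) eqn:E3; rewrite ?Nat.ltb_lt, ?Nat.ltb_ge in *; lia.
      * exists y. rewrite E1, E2. auto.
  - intros x Hx HS. assert (x <= list_max R) by (apply in_le_list_max; auto).
    assert (x < K) by lia. apply HN in HS. destruct (x <? K) eqn:E; rewrite ?Nat.ltb_lt, ?Nat.ltb_ge in *; lia.
Qed.

Section Trees.
Variables (F PR PC : Type) (c0 : F) (Th : cform F PC -> Prop) (P : rule F PR PC -> Prop).
Notation goal := (goal F PR PC).
Notation tree := (tree F PR PC).
Notation addr := (addr F PR PC).
Implicit Types (G g : goal) (tr : tree) (a b : addr).

Lemma on_path_bound tr b : exists N, forall x, on_path tr b x -> x < N.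
Proof.
  set (bl := fun b => match tlab tr b with Some g => S (list_max (goal_vars g)) | None => 0 end).
  assert (Hbl : forall b g x, tlab tr b = Some g -> In x (goal_vars g) -> x < bl b).
  { intros b' g x Hg Hx. unfold bl. rewrite Hg. apply Nat.lt_succ_r. apply in_le_list_max; auto. }
  induction b as [|i b [N IH]].
  - exists (bl []). intros x [b' [c [g [Hb [Hg Hx]]]]]. apply eq_sym, app_eq_nil in Hb as [-> ->]. eauto.
  - exists (Nat.max N (bl (i :: b))). intros x [b' [c [g [Hb [Hg Hx]]]]].
    destruct c as [|j c].
    + simpl in Hb. subst. specialize (Hbl _ _ _ Hg Hx). lia.
    + simpl in Hb. injection Hb as -> Hb. assert (x < N) by (apply IH; exists b', c, g; auto). lia.
Qed.

Lemma on_path_anc tr c b g x : tlab tr b = Some g -> In x (fvc (gcon g)) -> on_path tr (c ++ b) x.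
Proof.
  intros Hg Hx. exists b, c, g. repeat split; auto.
  unfold goal_vars. apply in_or_app; left; apply fvc_varsc; auto.
Qed.

Definition rest_of g n := firstn n (glits g) ++ skipn (S n) (glits g).

Definition no_rule_child (negc : tree -> addr -> goal -> atom F PR -> list (lit F PR) -> Prop) :=
  forall tr a g A rest, negc tr a g A rest -> forall r, tlab tr (Some r :: a) = None.

Lemma no_rule_child_t ltu : no_rule_child (t_neg Th ltu).
Proof. intros tr a g A rest [H|[C' [_ [_ [_ H]]]]] r; auto. Qed.

Lemma no_rule_child_tu lt : no_rule_child (tu_neg Th lt).
Proof. intros tr a g A rest [[_ H]|[[C'' [_ [_ [_ H]]]]|[H _]]] r; auto. Qed.

Section OneTree.
Variables (negc : tree -> addr -> goal -> atom F PR -> list (lit F PR) -> Prop) (G : goal) (tr : tree).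
Hypothesis HT : is_tree c0 Th P negc G tr.

Lemma tree_suffix c b g : tlab tr (c ++ b) = Some g -> exists g0, tlab tr b = Some g0.
Proof.
  revert g; induction c as [|i c IH]; intros g H; simpl in *; eauto.
  destruct HT as [_ [Hpar _]]. destruct (Hpar _ _ _ H) as [g0 H0]. eauto.
Qed.

Lemma tree_child i a g' : no_rule_child negc -> tlab tr (i :: a) = Some g' ->
  exists g, tlab tr a = Some g /\ tsel tr a < length (glits g) /\
  ((exists r r' A, i = Some r /\ nth_error (glits g) (tsel tr a) = Some (Pos A) /\ P r /\
       variant r' r /\ (forall x, In x (rule_vars r') -> ~ on_path tr a x) /\
       derives c0 g (tsel tr a) r' g' /\ satisfiable Th (gcon g'))
   \/ (exists A, i = None /\ nth_error (glits g) (tsel tr a) = Some (Neg A) /\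
       negc tr a g A (rest_of g (tsel tr a)))).
Proof.
  intros HNC Hg'. destruct (tree_suffix [i] a g' Hg') as [g Hg].
  destruct HT as [_ [_ H3]]. destruct (H3 a g Hg) as [Hleaf Hsel].
  destruct (glits g) as [|l ls] eqn:E.
  { specialize (Hleaf eq_refl i). congruence. }
  rewrite <- E in *. destruct Hsel as [Hlt Hl]. congruence.
  exists g. split; auto. split; auto.
  destruct (nth_error (glits g) (tsel tr a)) as [l'|] eqn:El.
  2:{ apply nth_error_None in El. lia. }
  specialize (Hl l' eq_refl). destruct l' as [A|A].
  - left. destruct Hl as [Hnone Hr]. destruct i as [r|]; [|congruence].
    destruct (proj1 (Hr r) g' Hg') as [HP [r' [? [? [? ?]]]]].
    exists r, r', A. repeat split; auto.
  - right. exists A. destruct i as [r|].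
    + rewrite (HNC _ _ _ _ _ Hl r) in Hg'. discriminate.
    + repeat split; auto.
Qed.

Lemma selected_step a g l : tlab tr a = Some g -> nth_error (glits g) (tsel tr a) = Some l ->
  match l with
  | Pos _ => atom_children c0 Th P tr a g (tsel tr a)
  | Neg A => negc tr a g A (rest_of g (tsel tr a))
  end.
Proof.
  intros Hg El. destruct HT as [_ [_ H3]]. destruct (H3 a g Hg) as [_ Hsel].
  apply Hsel; auto. intros E. rewrite E in El. destruct (tsel tr a); discriminate.
Qed.

Lemma branch_up_ind a gl (Pr : addr -> goal -> Prop) :
  tlab tr a = Some gl -> Pr a gl ->
  (forall i b g g', tlab tr b = Some g -> tlab tr (i :: b) = Some g' -> (exists c, a = c ++ i :: b) ->
     Pr (i :: b) g' -> Pr b g) ->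
  forall c b g, a = c ++ b -> tlab tr b = Some g -> Pr b g.
Proof.
  intros Hgl H0 Hstep c. induction c as [|i c IH] using rev_ind; intros b g Ha Hg.
  - simpl in Ha; subst. congruence.
  - rewrite <- app_assoc in Ha. simpl in Ha.
    assert (Hc := Ha). rewrite Ha in Hgl.
    edestruct tree_suffix as [g' Hg']; [exact Hgl|].
    eapply Hstep; eauto.
Qed.

Lemma branch_down_ind a (Pr : addr -> goal -> Prop) :
  Pr [] G ->
  (forall i b g g', tlab tr b = Some g -> tlab tr (i :: b) = Some g' -> (exists c, a = c ++ i :: b) ->
     Pr b g -> Pr (i :: b) g') ->
  forall c b g, a = c ++ b -> tlab tr b = Some g -> Pr b g.
Proof.
  intros H0 Hstep c b. revert c. induction b as [|i b IH]; intros c g Ha Hg.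
  - destruct HT as [H1 _]. rewrite H1 in Hg. injection Hg as <-. auto.
  - edestruct (tree_suffix [i]) as [g0 Hg0]; [exact Hg|].
    eapply Hstep; eauto. eapply (IH (c ++ [i])); eauto. rewrite <- app_assoc; auto.
Qed.

End OneTree.
End Trees.
Arguments rest_of {F PR PC}. Arguments no_rule_child {F PR PC}.

(** * Constraints expressible in the constraint language *)

(* The goals occurring in trees carry conjunctions of program constraints,
   renamed apart, and of (negated) answers.  They need not be constraints
   themselves, but they are equivalent to constraints; this is what the
   witness property is applied to. *)
Section Soundness.
Variables (F PC : Type) (c0 : F) (Constr : cform F PC -> Prop).
Hypothesis HConstr : constraint_language Constr.

Definition expressible (c : cform F PC) : Prop :=
  exists d, Constr d /\ forall M a, sat M a c <-> sat M a d.

Lemma expressible_Constr c : Constr c -> expressible c.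
Proof. intros; exists c; split; auto; tauto. Qed.

Lemma expressible_CEq t u : expressible (CEq t u).
Proof. apply expressible_Constr, HConstr. Qed.

Lemma expressible_CNot c : expressible c -> expressible (CNot c).
Proof.
  intros [d [Hd H]]. exists (CNot d). split. apply HConstr; auto.
  intros M a; simpl; rewrite H; tauto.
Qed.

Lemma expressible_CAnd c c' : expressible c -> expressible c' -> expressible (CAnd c c').
Proof.
  intros [d [Hd H]] [d' [Hd' H']]. exists (CAnd d d'). split. apply HConstr; auto.
  intros M a; simpl; rewrite H, H'; tauto.
Qed.

Lemma expressible_COr c c' : expressible c -> expressible c' -> expressible (COr c c').
Proof.
  intros [d [Hd H]] [d' [Hd' H']]. exists (COr d d'). split. apply HConstr; auto.
  intros M a; simpl; rewrite H, H'; tauto.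
Qed.

Lemma expressible_foldex c xs : expressible c -> expressible (fold_right CEx c xs).
Proof.
  intros He; induction xs as [|x xs IH]; simpl; auto.
  destruct IH as [d [Hd H]]. exists (CEx x d). split. apply HConstr; auto.
  intros M a; simpl. split; intros [dd Hs]; exists dd; apply H; auto.
Qed.

Lemma expressible_restrict c V : expressible c -> expressible (restrict c V).
Proof. intros; unfold restrict; apply expressible_foldex; auto. Qed.

Lemma Constr_conj cs : (forall c, In c cs -> Constr c) -> Constr (conj c0 cs).
Proof.
  induction cs as [|c cs IH]; intros H. apply HConstr.
  destruct cs as [|c' cs]. apply H; simpl; auto.
  change (conj c0 (c :: c' :: cs)) with (CAnd c (conj c0 (c' :: cs))).
  apply HConstr. apply H; simpl; auto. apply IH. intros; apply H; simpl in *; tauto.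
Qed.

Lemma Constr_foldex c xs : Constr c -> Constr (fold_right CEx c xs).
Proof. intros H; induction xs; simpl; auto. apply HConstr; auto. Qed.

Lemma expressible_conj cs : (forall c, In c cs -> expressible c) -> expressible (conj c0 cs).
Proof.
  induction cs as [|c cs IH]; intros H. apply expressible_CEq.
  destruct cs as [|c' cs]. apply H; simpl; auto.
  change (conj c0 (c :: c' :: cs)) with (CAnd c (conj c0 (c' :: cs))).
  apply expressible_CAnd. apply H; simpl; auto. apply IH. intros; apply H; simpl in *; tauto.
Qed.

Lemma expressible_disj cs : (forall c, In c cs -> expressible c) -> expressible (disj c0 cs).
Proof.
  induction cs as [|c cs IH]; intros H. apply expressible_CNot, expressible_CEq.
  destruct cs as [|c' cs]. apply H; simpl; auto.
  change (disj c0 (c :: c' :: cs)) with (COr c (disj c0 (c' :: cs))).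
  apply expressible_COr. apply H; simpl; auto. apply IH. intros; apply H; simpl in *; tauto.
Qed.

Lemma expressible_eqs ts us : expressible (eqs c0 ts us).
Proof.
  unfold eqs. apply expressible_conj. intros c Hc. apply in_map_iff in Hc as [[t u] [<- _]].
  apply expressible_CEq.
Qed.

(* The language is not assumed closed under renaming, so the
   renaming of a constraint d by pi is expressed with fresh variables x + N:
   [read_shifted d N] says that d holds when each free x is read at x + N, and
   [rename_formula] then equates x + N with pi x. *)
Definition read_shifted (d : cform F PC) (N : nat) : cform F PC :=
  fold_right CEx (CAnd d (conj c0 (map (fun x => CEq (Var x) (Var (x + N))) (fvc d)))) (fvc d).

Definition rename_formula (d : cform F PC) (pi : nat -> nat) (N : nat) : cform F PC :=
  fold_right CEx
    (CAnd (conj c0 (map (fun x => CEq (Var (x + N)) (Var (pi x))) (fvc d))) (read_shifted d N))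
    (map (fun x => x + N) (fvc d)).

Lemma Constr_rename_formula d pi N : Constr d -> Constr (rename_formula d pi N).
Proof.
  intros Hd. apply Constr_foldex. apply HConstr.
  - apply Constr_conj. intros c' Hc'. apply in_map_iff in Hc' as [x [<- _]]. apply HConstr.
  - apply Constr_foldex. apply HConstr; auto.
    apply Constr_conj. intros c' Hc'. apply in_map_iff in Hc' as [x [<- _]]. apply HConstr.
Qed.

Lemma sat_read_shifted M b d N : (forall x, In x (fvc d) -> x < N) ->
  sat M b (read_shifted d N) <-> sat M (fun x => b (x + N)) d.
Proof.
  intros HN. unfold read_shifted. rewrite sat_foldex. split.
  - intros [a [Ha [Hd Heq]]]. revert Hd. apply sat_ext. intros x Hx.
    rewrite sat_conj in Heq.
    specialize (Heq _ (in_map (fun x => CEq (Var x) (Var (x + N))) _ _ Hx)). simpl in Heq.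
    rewrite Heq. symmetry. apply Ha. intros Hin. apply HN in Hin. lia.
  - intros Hd. exists (fun y => if in_dec Nat.eq_dec y (fvc d) then b (y + N) else b y). split.
    { intros x Hx. destruct (in_dec _ _ _); tauto. }
    simpl. split.
    + revert Hd. apply sat_ext. intros x Hx. destruct (in_dec _ _ _); tauto.
    + apply sat_conj. intros c' Hc'. apply in_map_iff in Hc' as [x [<- Hx]]. simpl.
      destruct (in_dec Nat.eq_dec x (fvc d)) as [_|n]; [|tauto].
      destruct (in_dec Nat.eq_dec (x + N) (fvc d)) as [i|_]; [apply HN in i; lia|reflexivity].
Qed.

Lemma sat_rename_formula M a d pi N : (forall x, In x (fvc d) -> x < N /\ pi x < N) ->
  sat M a (rename_formula d pi N) <-> sat M (fun x => a (pi x)) d.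
Proof.
  intros HN. unfold rename_formula. rewrite sat_foldex.
  assert (Hws : forall y, In y (map (fun x => x + N) (fvc d)) -> N <= y).
  { intros y Hy. apply in_map_iff in Hy as [x [<- _]]. lia. }
  split.
  - intros [b [Hb [Heq Hd]]]. apply sat_read_shifted in Hd; [|apply HN].
    revert Hd. apply sat_ext. intros x Hx. rewrite sat_conj in Heq.
    specialize (Heq _ (in_map (fun x => CEq (Var (x + N)) (Var (pi x))) _ _ Hx)). simpl in Heq.
    rewrite Heq. symmetry. apply Hb. intros Hin. apply Hws in Hin. specialize (HN x Hx). lia.
  - intros Hd. exists (fun y => if in_dec Nat.eq_dec y (map (fun x => x + N) (fvc d))
                               then a (pi (y - N)) else a y). split.
    { intros x Hx. destruct (in_dec _ _ _); tauto. }
    simpl. split.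
    + apply sat_conj. intros c' Hc'. apply in_map_iff in Hc' as [x [<- Hx]]. simpl.
      destruct (in_dec Nat.eq_dec (x + N) _) as [_|n].
      2:{ exfalso; apply n; apply (in_map (fun x => x + N)); auto. }
      destruct (in_dec Nat.eq_dec (pi x) _) as [i|_].
      { apply Hws in i. specialize (HN x Hx). lia. }
      replace (x + N - N) with x by lia. reflexivity.
    + apply sat_read_shifted; [apply HN|]. revert Hd. apply sat_ext. intros x Hx.
      destruct (in_dec Nat.eq_dec (x + N) _) as [_|n].
      2:{ exfalso; apply n; apply (in_map (fun x => x + N)); auto. }
      replace (x + N - N) with x by lia. reflexivity.
Qed.

Lemma expressible_cren pi c : (forall x y, pi x = pi y -> x = y) ->
  expressible c -> expressible (cren pi c).
Proof.
  intros Hpi [d [Hd Hc]].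
  set (N := S (list_max (fvc d ++ map pi (fvc d)))).
  assert (HN : forall x, In x (fvc d) -> x < N /\ pi x < N).
  { intros x Hx. unfold N. split; apply Nat.lt_succ_r, in_le_list_max, in_or_app;
      [left | right; apply in_map]; auto. }
  exists (rename_formula d pi N). split; [apply Constr_rename_formula; auto|].
  intros M a. rewrite sat_cren, Hc, sat_rename_formula; auto. reflexivity.
Qed.

Variables (PR : Type) (arF : F -> nat) (arR : PR -> nat) (arC : PC -> nat).
Variables (Th : cform F PC -> Prop) (P : rule F PR PC -> Prop).
Hypothesis HP : hybrid_program arF arR arC Constr P.

Notation goal := (goal F PR PC).
Notation tree := (tree F PR PC).

Definition wf_goal (g : goal) : Prop :=
  expressible (gcon g) /\ Forall (wfl arF arR) (glits g).

Lemma wf_goal_ok (g : goal) : goal_ok arF arR Constr g -> wf_goal g.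
Proof. intros [H1 H2]. split; auto. apply expressible_Constr; auto. Qed.

(* The goal  C, A  used to ask for (negative) answers about A. *)
Lemma wf_goal_single (g : goal) A : wf_goal g -> In (Neg A) (glits g) -> wf_goal (Goal (gcon g) [Pos A]).
Proof.
  intros [HE HW] HA. split; simpl; auto. constructor; auto.
  rewrite Forall_forall in HW. apply (HW _ HA).
Qed.

Lemma wf_resolvent (g g' : goal) n r r' : wf_goal g -> P r -> variant r' r ->
  derives c0 g n r' g' -> wf_goal g'.
Proof.
  intros [HE HW] HPr Hv [p [ts [us [Hn [Hh [Hlen ->]]]]]].
  destruct (variant_ren _ _ Hv) as [pi [Hpi ->]].
  destruct (HP r HPr) as [[Hwh [_ Hwb]] HC].
  split; simpl.
  - apply expressible_CAnd; [apply expressible_eqs; auto|]. apply expressible_CAnd; auto.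
    apply expressible_cren; auto. apply expressible_Constr; auto.
  - rewrite Forall_forall in *. intros l Hl. apply in_app_iff in Hl as [Hl|Hl].
    { apply HW; eapply in_firstn; exact Hl. }
    apply in_app_iff in Hl as [Hl|Hl].
    + apply in_map_iff in Hl as [l' [<- Hl']]. apply wfl_ren. auto.
    + apply HW; apply (in_skipn (S n)); exact Hl.
Qed.

Lemma wf_rest (g : goal) n : Forall (wfl arF arR) (glits g) -> Forall (wfl arF arR) (rest_of g n).
Proof.
  rewrite !Forall_forall. intros H l Hl. apply H. eapply in_around; exact Hl.
Qed.

Lemma tree_wf negc (G : goal) tr : no_rule_child negc ->
  (forall a g A rest g', negc tr a g A rest -> wf_goal g -> wfa arF arR A ->
     Forall (wfl arF arR) rest -> tlab tr (None :: a) = Some g' -> wf_goal g') ->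
  is_tree c0 Th P negc G tr -> wf_goal G -> forall a g, tlab tr a = Some g -> wf_goal g.
Proof.
  intros HNC Hneg HT HG a. induction a as [|i a IH]; intros g Hg.
  - destruct HT as [H1 _]. congruence.
  - edestruct (tree_child) as [g0 [Hg0 [Hlt [Hp|Hn]]]]; [exact HT|exact HNC|exact Hg| |].
    + destruct Hp as [r [r' [A [-> [HA [HPr [Hv [Hfr [Hd _]]]]]]]]].
      eapply wf_resolvent; [apply (IH g0 Hg0)|exact HPr|exact Hv|exact Hd].
    + destruct Hn as [A [-> [HA Hneg']]]. destruct (IH g0 Hg0) as [HE HW].
      eapply Hneg; eauto; [|apply wf_rest; auto].
      rewrite Forall_forall in HW. apply (HW (Neg A)). eapply nth_error_In; eauto.
Qed.

Lemma t_neg_wf (ltu : goal -> cform F PC -> Prop) :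
  (forall G C, ltu G C -> wf_goal G -> expressible C) ->
  forall tr a g A rest g', t_neg Th ltu tr a g A rest -> wf_goal g -> wfa arF arR A ->
     Forall (wfl arF arR) rest -> tlab tr (None :: a) = Some g' -> wf_goal g'.
Proof.
  intros Hl tr a g A rest g' [Hleaf|[C' [HC' [_ [Hs _]]]]] Hi HA Hr Hg'.
  - rewrite Hleaf in Hg'. discriminate.
  - rewrite Hs in Hg'. injection Hg' as <-. split; simpl; auto.
    apply expressible_CAnd; [|apply Hi]. eapply Hl; eauto.
    split; simpl; [apply Hi|]. constructor; auto.
Qed.

Lemma tu_neg_wf (lt : goal -> cform F PC -> Prop) :
  (forall G C, lt G C -> wf_goal G -> expressible C) ->
  forall tr a g A rest g', tu_neg Th lt tr a g A rest -> wf_goal g -> wfa arF arR A ->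
     Forall (wfl arF arR) rest -> tlab tr (None :: a) = Some g' -> wf_goal g'.
Proof.
  intros Hl tr a g A rest g' [[Hs _]|[[C'' [HC' [_ [Hs _]]]]|[Hleaf _]]] Hi HA Hr Hg'.
  - rewrite Hs in Hg'. injection Hg' as <-. split; simpl; auto. apply Hi.
  - rewrite Hs in Hg'. injection Hg' as <-. split; simpl; auto.
    apply expressible_CAnd; [|apply Hi]. apply expressible_CNot. eapply Hl; eauto.
    split; simpl; [apply Hi|]. constructor; auto.
  - rewrite Hleaf in Hg'. discriminate.
Qed.

Lemma answer_expressible (G : goal) tr C : (forall a g, tlab tr a = Some g -> wf_goal g) ->
  answer c0 tr G C -> expressible C.
Proof.
  intros HI [cs [Hcs ->]]. apply expressible_restrict, expressible_disj; auto.
  intros c Hc. destruct (Hcs c Hc) as [a [g [Hg [_ <-]]]]. apply (HI a g Hg).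
Qed.

Lemma nanswer_expressible (G : goal) tr C : (forall a g, tlab tr a = Some g -> wf_goal g) ->
  nanswer c0 Constr Th tr G C -> expressible C.
Proof.
  intros HI [S [_ [[cs [Hcs ->]]|[_ [HC _]]]]].
  - apply expressible_conj; auto. intros c' Hc'. apply in_map_iff in Hc' as [c [<- Hc]].
    apply expressible_CNot, expressible_restrict. apply Hcs in Hc as [a [g [_ [Hg <-]]]].
    apply (HI a g Hg).
  - apply expressible_Constr; auto.
Qed.

Lemma low_expressible k :
  (forall G C, fst (low c0 Constr Th P k) G C -> wf_goal G -> expressible C) /\
  (forall G C, snd (low c0 Constr Th P k) G C -> wf_goal G -> expressible C).
Proof.
  induction k as [|k [IH1 IH2]|f IH]; simpl.
  - split; intros; contradiction.
  - split.
    + intros G C [H|[tr [HT HA]]] HG; eauto. eapply answer_expressible; eauto.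
      eapply tree_wf; [apply no_rule_child_t | apply t_neg_wf, IH2 | exact HT | exact HG].
    + intros G C [H|[tr [HT HA]]] HG; eauto. eapply nanswer_expressible; eauto.
      eapply tree_wf; [apply no_rule_child_tu | apply tu_neg_wf, IH1 | exact HT | exact HG].
  - split; intros G C [n H] HG; [eapply (proj1 (IH n)) | eapply (proj2 (IH n))]; eauto.
Qed.

Lemma t_tree_wf k (G : goal) tr : t_tree c0 Constr Th P k G tr -> wf_goal G ->
  forall a g, tlab tr a = Some g -> wf_goal g.
Proof.
  intros HT HG. eapply tree_wf; [apply no_rule_child_t | | exact HT | exact HG].
  apply t_neg_wf, (proj2 (low_expressible k)).
Qed.

Lemma tu_tree_wf k (G : goal) tr : tu_tree c0 Constr Th P k G tr -> wf_goal G ->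
  forall a g, tlab tr a = Some g -> wf_goal g.
Proof.
  intros HT HG. eapply tree_wf; [apply no_rule_child_tu | | exact HT | exact HG].
  apply tu_neg_wf, (proj1 (low_expressible k)).
Qed.

Lemma nanswer_fv (tr : tree) (G : goal) C :
  nanswer c0 Constr Th tr G C -> forall x, In x (fvc C) -> In x (fvg G).
Proof.
  intros [S [_ [[cs [_ ->]]|[_ [_ [H _]]]]]]; auto.
  intros x Hx. apply fvc_conj in Hx as [c' [Hc' Hx]]. apply in_map_iff in Hc' as [c [<- _]].
  simpl in Hx. eapply fvc_restrict; eauto.
Qed.

Lemma low_nanswer_fv k (G : goal) C :
  snd (low c0 Constr Th P k) G C -> forall x, In x (fvc C) -> In x (fvg G).
Proof.
  revert G C. induction k as [|k IH|f IH]; simpl.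
  - contradiction.
  - intros G C [H|[tr [_ HN]]]; eauto. eapply nanswer_fv; eauto.
  - intros G C [n H]; eauto.
Qed.

(** * Claim (1): walking up a successful branch of a t-tree *)

(* The model M0 of T; the constant c0 completes partial ground substitutions. *)
Hypothesis Hc0 : arF c0 = 0.
Hypothesis HTh : theory_ok arF arC Th.
Variable M0 : structure F PC.
Hypothesis HM0 : model Th M0.

Notation Q := (ground_prog arF c0 P M0).
Notation I k := (psi_up arF arR Q k).
Notation asg s := (fun x => geval c0 M0 (s x)).
Notation t_answers k := (fst (low c0 Constr Th P k)).
Notation tu_answers k := (snd (low c0 Constr Th P k)).

Definition ground_subst (s : nat -> term F) : Prop := forall x, gwft arF (s x).

Definition t_sound k : Prop :=
  forall (G : goal) C s, wf_goal G -> ground_subst s -> t_answers k G C ->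
    sat M0 (asg s) C -> true3 (I k) (map (lsubst s) (glits G)).

Definition tu_sound k : Prop :=
  forall (G : goal) C s, wf_goal G -> ground_subst s -> tu_answers k G C ->
    sat M0 (asg s) (gcon G) -> sat M0 (asg s) C -> false3 (I k) (map (lsubst s) (glits G)).

Lemma M0_CET : CET arF M0.
Proof. apply (proj2 HTh); auto. Qed.

(* A satisfied resolution step instantiates to a clause of P/M0: the head
   of the ground instance is the selected atom, by Clark's equality theory. *)
Lemma ground_resolvent s p ts us r pi :
  ground_subst s -> P r -> (forall x y, pi x = pi y -> x = y) ->
  Forall (wft arF) ts -> rhead (ren_rule pi r) = RA p us -> length ts = length us ->
  sat M0 (asg s) (eqs c0 ts us) -> sat M0 (asg s) (rcon (ren_rule pi r)) ->
  Q (asubst s (RA p ts)) (map (lsubst s) (rbody (ren_rule pi r))).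
Proof.
  intros Hs HPr Hpi Hts Hh Hl He Hc.
  destruct (HP r HPr) as [[Hwh _] _].
  exists r. split; auto. exists (fun x => s (pi x)). split; [intros x; apply Hs|]. split.
  { unfold sat_inst. simpl in Hc. apply sat_cren in Hc; auto. }
  split.
  - assert (E : asubst s (rhead (ren_rule pi r)) = asubst (fun x => s (pi x)) (rhead r)).
    { simpl. rewrite asubst_asubst. reflexivity. }
    rewrite <- E, Hh. simpl. f_equal. apply sat_eqs in He; auto.
    assert (Hwus : Forall (wft arF) us).
    { assert (W := wfa_ren _ _ arF arR pi (rhead r) Hwh). simpl in Hh. rewrite Hh in W. apply W. }
    apply (map_geval_inj _ _ arF c0 M0 M0_CET).
    + rewrite Forall_forall in *. intros u Hu. apply in_map_iff in Hu as [t [<- Ht]].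
      apply gwft_tsubst; auto.
    + rewrite Forall_forall in *. intros u Hu. apply in_map_iff in Hu as [t [<- Ht]].
      apply gwft_tsubst; auto.
    + rewrite !map_map, !(map_ext (fun x => geval c0 M0 (tsubst s x)) (eval M0 (asg s)))
        by (intros; apply geval_tsubst).
      exact He.
  - simpl. rewrite map_map. apply map_ext. intros l. rewrite lsubst_lsubst. reflexivity.
Qed.

Definition true_after (J : interp F PR) (l : lit F PR) : Prop :=
  match l with Pos a => Psi arF arR Q J (Pos a) | Neg a => J (Neg a) end.

Section UpTheBranch.
Variables (k : ord) (G : goal) (tr : tree) (s : nat -> term F).
Hypothesis HT : t_tree c0 Constr Th P k G tr.
Hypothesis HG : wf_goal G.
Hypothesis Hs : ground_subst s.
Hypothesis Hsound : tu_sound k.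

Lemma branch_step_up i b g g' :
  tlab tr b = Some g -> tlab tr (i :: b) = Some g' ->
  sat M0 (asg s) (gcon g') -> (forall l, In l (glits g') -> true_after (I k) (lsubst s l)) ->
  sat M0 (asg s) (gcon g) /\ forall l, In l (glits g) -> true_after (I k) (lsubst s l).
Proof.
  intros Hg Hg' IHs IHl.
  assert (HI := t_tree_wf k G tr HT HG).
  edestruct (tree_child) as [g0 [Hg0 [Hlt [Hp|Hn]]]]; [exact HT|apply no_rule_child_t|exact Hg'|..];
    rewrite Hg in Hg0; injection Hg0 as <-.
  - destruct Hp as [r [r' [A [-> [HA [HPr [Hv [Hfr [Hd _]]]]]]]]].
    destruct Hd as [p [ts [us [Hn [Hh [Hlen ->]]]]]]. simpl in IHs, IHl.
    destruct IHs as [He [Hs0 Hc]].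
    destruct (variant_ren _ _ Hv) as [pi [Hpi ->]].
    assert (Hbody : forall l, In l (rbody (ren_rule pi r)) -> true_after (I k) (lsubst s l)).
    { intros l Hl. apply IHl, in_or_app; right; apply in_or_app; auto. }
    split; auto. intros l Hl.
    destruct (in_split_at _ _ _ _ Hn Hl) as [->|Hl'].
    + simpl. apply lhm_rule with (map (lsubst s) (rbody (ren_rule pi r))).
      * eapply ground_resolvent; eauto. destruct (HI _ _ Hg) as [_ HW]. rewrite Forall_forall in HW.
        apply (HW _ (nth_error_In _ _ Hn)).
      * intros a0 Ha0. apply in_map_iff in Ha0 as [l0 [Hl0 Hin]].
        specialize (Hbody l0 Hin). rewrite Hl0 in Hbody. exact Hbody.
      * intros a0 Ha0. apply in_map_iff in Ha0 as [l0 [Hl0 Hin]].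
        specialize (Hbody l0 Hin). rewrite Hl0 in Hbody. exact Hbody.
    + apply IHl. apply in_around_mid; auto.
  - destruct Hn as [A [-> [HA [Hleaf|[C' [HC' [_ [Hs' _]]]]]]]].
    { rewrite Hleaf in Hg'. discriminate. }
    rewrite Hs' in Hg'. injection Hg' as <-. simpl in IHs, IHl. destruct IHs as [HsC Hsg].
    split; auto. intros l Hl. destruct (in_split_at _ _ _ _ HA Hl) as [->|Hl'].
    + assert (HGi := wf_goal_single _ _ (HI _ _ Hg) Hl).
      destruct (Hsound _ _ s HGi Hs HC' Hsg HsC) as [l' [Hl'' Hf]]. simpl in Hl''.
      destruct Hl'' as [<-|[]]. exact Hf.
    + apply IHl. auto.
Qed.

Lemma branch_up_true a gl : tlab tr a = Some gl -> glits gl = [] -> sat M0 (asg s) (gcon gl) ->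
  forall c b g, a = c ++ b -> tlab tr b = Some g ->
  sat M0 (asg s) (gcon g) /\ forall l, In l (glits g) -> true_after (I k) (lsubst s l).
Proof.
  intros Hgl Hnil Hsat.
  apply (branch_up_ind _ _ _ _ _ _ _ _ _ HT a gl
    (fun b g => sat M0 (asg s) (gcon g) /\ forall l, In l (glits g) -> true_after (I k) (lsubst s l)));
    auto.
  - split; auto. rewrite Hnil. intros _ [].
  - intros i b g g' Hg Hg' _ [IHs IHl]. eapply branch_step_up; eauto.
Qed.

End UpTheBranch.

(* The constraints only grow down a branch of a t-tree, so an assignment
   satisfying a leaf satisfies every constraint on its branch. *)
Lemma branch_up_sat k (G : goal) tr a gl a0 : t_tree c0 Constr Th P k G tr -> tlab tr a = Some gl ->
  sat M0 a0 (gcon gl) -> forall c b g, a = c ++ b -> tlab tr b = Some g -> sat M0 a0 (gcon g).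
Proof.
  intros HT Hgl Hs.
  apply (branch_up_ind _ _ _ _ _ _ _ _ _ HT a gl (fun b g => sat M0 a0 (gcon g)) Hgl Hs).
  intros i b g g' Hg Hg' _ IH.
  edestruct (tree_child) as [g0 [Hg0 [Hlt [Hp|Hn]]]]; [exact HT|apply no_rule_child_t|exact Hg'|..];
    rewrite Hg in Hg0; injection Hg0 as <-.
  - destruct Hp as [r [r' [A [-> [HA [HPr [Hv [Hfr [Hd _]]]]]]]]].
    destruct Hd as [p [ts [us [Hn [Hh [Hlen ->]]]]]]. apply IH.
  - destruct Hn as [A [-> [HA [Hleaf|[C' [HC' [_ [Hs' _]]]]]]]].
    { rewrite Hleaf in Hg'. discriminate. }
    rewrite Hs' in Hg'. injection Hg' as <-. apply IH.
Qed.

Lemma ground_instance (c : cform F PC) (V : list nat) a0 (theta : nat -> term F) :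
  (forall x, In x V -> gwft arF (theta x) /\ a0 x = geval c0 M0 (theta x)) ->
  sat M0 a0 c ->
  (forall x, In x (fvc c) -> exists u, gwft arF u /\ a0 x = geval c0 M0 u) ->
  exists s, ground_subst s /\ sat M0 (asg s) c /\ (forall x, In x V -> s x = theta x).
Proof.
  intros HV Hs Hd.
  assert (H : forall x, exists u, gwft arF u /\ (In x (fvc c) -> a0 x = geval c0 M0 u)).
  { intros x. destruct (classic (In x (fvc c))) as [Hx|Hx].
    - destruct (Hd x Hx) as [u [? ?]]; eauto.
    - exists (App c0 []). split; [|tauto]. split; simpl; auto. }
  apply choice in H as [s1 Hs1].
  exists (fun x => if in_dec Nat.eq_dec x V then theta x else s1 x). split; [|split].
  - intros x. destruct (in_dec _ _ _); [apply HV|apply Hs1]; auto.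
  - revert Hs. apply sat_ext. intros x Hx. destruct (in_dec _ _ _).
    + symmetry; apply HV; auto.
    + symmetry; apply Hs1; auto.
  - intros x Hx. destruct (in_dec _ _ _); tauto.
Qed.

Section SafeProgram.
Hypothesis Hsafe : safe_program arF Th P.
Notation denoted a0 := (denoted arF M0 a0).

Lemma safe_vars_denoted r pi a0 y : P r -> (forall x y, pi x = pi y -> x = y) ->
  sat M0 a0 (rcon (ren_rule pi r)) ->
  (forall A x, In (Pos A) (rbody (ren_rule pi r)) -> In x (fva A) -> denoted a0 x) ->
  (In y (fva (rhead r)) \/ (exists A, In (Neg A) (rbody r) /\ In y (fva A)) \/ In y (fvc (rcon r))) ->
  denoted a0 (pi y).
Proof.
  intros HPr Hpi Hsat Hpos Hy. apply (proj1 (sat_cren _ _ M0 a0 pi (rcon r) Hpi)) in Hsat.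
  destruct (Hsafe r HPr y Hy) as [[t [Ht Hb]]|[z [A [HA [Hz Hb]]]]].
  - specialize (Hb M0 HM0 _ Hsat). simpl in Hb. exists t. split; auto.
    rewrite Hb. rewrite !(eval_ground _ _ c0) by apply Ht. reflexivity.
  - specialize (Hb M0 HM0 _ Hsat). simpl in Hb. unfold denoted. rewrite Hb.
    apply (Hpos (asubst (fun x => Var (pi x)) A)).
    + simpl. apply in_map_iff. exists (Pos A). split; auto.
    + apply fva_ren. eauto.
Qed.

Lemma renamed_rule_denoted r pi a0 : P r -> (forall x y, pi x = pi y -> x = y) ->
  sat M0 a0 (rcon (ren_rule pi r)) ->
  (forall A x, In (Pos A) (rbody (ren_rule pi r)) -> In x (fva A) -> denoted a0 x) ->
  (forall x, In x (fva (rhead (ren_rule pi r))) -> denoted a0 x) /\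
  (forall l x, In l (rbody (ren_rule pi r)) -> In x (fvl l) -> denoted a0 x) /\
  (forall x, In x (fvc (rcon (ren_rule pi r))) -> denoted a0 x).
Proof.
  intros HPr Hpi Hsat Hpos. split; [|split].
  - intros x Hx. simpl in Hx. apply fva_ren in Hx as [y [Hy ->]]. eapply safe_vars_denoted; eauto.
  - intros l x Hl Hx. simpl in Hl. apply in_map_iff in Hl as [[A|A] [<- Hl0]].
    + apply (Hpos (asubst (fun x => Var (pi x)) A)); auto. simpl. apply in_map_iff.
      exists (Pos A); auto.
    + apply fvl_ren in Hx as [y [Hy ->]]. eapply safe_vars_denoted; eauto.
  - intros x Hx. apply fvc_cren in Hx as [y [Hy ->]]; auto. eapply safe_vars_denoted; eauto.
Qed.

Section Branch.
Variables (k : ord) (G : goal) (tr : tree) (a : addr F PR PC) (gl : goal) (a0 : nat -> dom M0).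
Hypothesis HT : t_tree c0 Constr Th P k G tr.
Hypothesis HG : wf_goal G.
Hypothesis Hgl : tlab tr a = Some gl.
Hypothesis Hnil : glits gl = [].
Hypothesis Hsat : sat M0 a0 (gcon gl).

(* Upwards: the variables of the positive literals on the branch are
   denoted, since each one is eventually resolved with a safe rule. *)
Lemma branch_atoms_denoted : forall c b g, a = c ++ b -> tlab tr b = Some g ->
  forall A x, In (Pos A) (glits g) -> In x (fva A) -> denoted a0 x.
Proof.
  assert (HI := t_tree_wf k G tr HT HG).
  apply (branch_up_ind _ _ _ _ _ _ _ _ _ HT a gl
     (fun b g => forall A x, In (Pos A) (glits g) -> In x (fva A) -> denoted a0 x) Hgl).
  { rewrite Hnil. intros _ _ []. }
  intros i b g g' Hg Hg' [c Hc] IH.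
  assert (HS' := branch_up_sat k G tr a gl a0 HT Hgl Hsat c (i :: b) g' Hc Hg').
  edestruct (tree_child) as [g0 [Hg0 [Hlt [Hp|Hn]]]]; [exact HT|apply no_rule_child_t|exact Hg'|..];
    rewrite Hg in Hg0; injection Hg0 as <-.
  - destruct Hp as [r [r' [A0 [-> [HA [HPr [Hv [Hfr [Hd _]]]]]]]]].
    destruct Hd as [p [ts [us [Hn [Hh [Hlen ->]]]]]].
    destruct (variant_ren _ _ Hv) as [pi [Hpi ->]].
    simpl in HS', IH. destruct HS' as [He [_ Hc']].
    destruct (renamed_rule_denoted r pi a0 HPr Hpi Hc') as [Hhead _].
    { intros A x HA' Hx. apply (IH A x); auto. apply in_app_iff; right; apply in_app_iff; auto. }
    rewrite Hh in Hhead. destruct (HP r HPr) as [[Hwh _] _].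
    assert (Hwus : Forall (wft arF) us).
    { assert (W := wfa_ren _ _ arF arR pi (rhead r) Hwh). simpl in Hh. rewrite Hh in W. apply W. }
    intros A x HAin Hx. destruct (in_split_at _ _ _ _ Hn HAin) as [HE|Hl'].
    2:{ apply (IH A x); auto. apply in_around_mid; auto. }
    (* the selected atom equals the head, whose variables are denoted *)
    injection HE as ->. simpl in Hx. unfold fvts in Hx. apply in_flat_map in Hx as [t [Ht Hxt]].
    apply sat_eqs in He; auto.
    destruct (in_map2_eval _ _ _ _ _ _ _ _ He Ht) as [u [Hu Htu]].
    rewrite Forall_forall in Hwus.
    apply (denoted_eq _ _ arF M0 M0_CET a0 t u); auto.
    + destruct (HI _ _ Hg) as [_ HW]. rewrite Forall_forall in HW.
      specialize (HW _ (nth_error_In _ _ Hn)). destruct HW as [_ HW]. rewrite Forall_forall in HW; auto.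
    + intros y Hy. apply Hhead. simpl. unfold fvts. apply in_flat_map; eauto.
  - destruct Hn as [A0 [-> [HA [Hleaf|[C' [HC' [_ [Hs' _]]]]]]]].
    { rewrite Hleaf in Hg'. discriminate. }
    rewrite Hs' in Hg'. injection Hg' as <-. simpl in IH.
    intros A x HAin Hx. destruct (in_split_at _ _ _ _ HA HAin) as [HE|Hl']. discriminate.
    apply (IH A x); auto.
Qed.

Lemma branch_vars_denoted : (forall x, In x (fvg G) -> denoted a0 x) ->
  forall c b g, a = c ++ b -> tlab tr b = Some g ->
  (forall l x, In l (glits g) -> In x (fvl l) -> denoted a0 x) /\
  (forall x, In x (fvc (gcon g)) -> denoted a0 x).
Proof.
  intros HGd.
  apply (branch_down_ind _ _ _ _ _ _ _ _ _ HT a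
     (fun b g => (forall l x, In l (glits g) -> In x (fvl l) -> denoted a0 x) /\
                 (forall x, In x (fvc (gcon g)) -> denoted a0 x))).
  { split.
    - intros l x Hl Hx. apply HGd. unfold fvg. apply in_or_app; right. apply in_flat_map; eauto.
    - intros x Hx. apply HGd. unfold fvg. apply in_or_app; auto. }
  intros i b g g' Hg Hg' [c Hc] [IHl IHc].
  assert (HS' := branch_up_sat k G tr a gl a0 HT Hgl Hsat c (i :: b) g' Hc Hg').
  assert (HA1 := branch_atoms_denoted c (i :: b) g' Hc Hg').
  edestruct (tree_child) as [g0 [Hg0 [Hlt [Hp|Hn]]]]; [exact HT|apply no_rule_child_t|exact Hg'|..];
    rewrite Hg in Hg0; injection Hg0 as <-.
  - destruct Hp as [r [r' [A0 [-> [HA [HPr [Hv [Hfr [Hd _]]]]]]]]].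
    destruct Hd as [p [ts [us [Hn [Hh [Hlen ->]]]]]].
    destruct (variant_ren _ _ Hv) as [pi [Hpi ->]].
    simpl in HS', HA1. destruct HS' as [He [_ Hc']].
    destruct (renamed_rule_denoted r pi a0 HPr Hpi Hc') as [Hhead [Hbody Hcon]].
    { intros A x HA' Hx. apply (HA1 A x); auto. apply in_app_iff; right; apply in_app_iff; auto. }
    rewrite Hh in Hhead. split; simpl.
    + intros l x Hl Hx. apply in_app_iff in Hl as [Hl|Hl].
      { apply (IHl l x); auto. eapply in_firstn; eauto. }
      apply in_app_iff in Hl as [Hl|Hl]; [apply (Hbody l x); auto|].
      apply (IHl l x); auto. apply (in_skipn (S (tsel tr b))); auto.
    + intros x Hx. apply in_app_iff in Hx as [Hx|Hx].
      * apply fvc_eqs in Hx as [Hx|Hx]; auto. apply (IHl (Pos (RA p ts)) x); auto.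
        eapply nth_error_In; eauto.
      * apply in_app_iff in Hx as [Hx|Hx]; auto.
  - destruct Hn as [A0 [-> [HA [Hleaf|[C' [HC' [_ [Hs' _]]]]]]]].
    { rewrite Hleaf in Hg'. discriminate. }
    rewrite Hs' in Hg'. injection Hg' as <-. simpl. split.
    + intros l x Hl Hx. apply (IHl l x); auto. eapply in_around; eauto.
    + intros x Hx. apply in_app_iff in Hx as [Hx|Hx]; auto.
      apply (low_nanswer_fv k) with (x := x) in HC'; auto.
      unfold fvg in HC'. simpl in HC'. apply in_app_iff in HC' as [H|H]; auto.
      rewrite app_nil_r in H. apply (IHl (Neg A0) x); auto. eapply nth_error_In; eauto.
Qed.

End Branch.
End SafeProgram.

Lemma leaf_ground_instance k (G : goal) tr a gl a0 (theta : nat -> term F) :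
  herbrand arF c0 M0 \/ witness_property arF c0 Constr Th \/ safe_program arF Th P ->
  t_tree c0 Constr Th P k G tr -> wf_goal G -> tlab tr a = Some gl -> glits gl = [] ->
  sat M0 a0 (gcon gl) ->
  (forall x, In x (fvg G) -> gwft arF (theta x) /\ a0 x = geval c0 M0 (theta x)) ->
  exists s, ground_subst s /\ sat M0 (asg s) (gcon gl) /\ (forall x, In x (fvg G) -> s x = theta x).
Proof.
  intros Hcase HT HG Hgl Hnil Hs HV.
  destruct Hcase as [[Hsurj _]|[Hw|Hsafe]].
  - (* Herbrand model: every element is the value of a ground term *)
    apply ground_instance with a0; auto. intros x _. destruct (Hsurj (a0 x)) as [u [? ?]]; eauto.
  - (* witness property, applied to  gl's constraint /\ x = theta x  (x in G) *)
    set (c' := CAnd (gcon gl) (conj c0 (map (fun x => CEq (Var x) (theta x)) (fvg G)))).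
    assert (HE : expressible c').
    { apply expressible_CAnd; [apply (t_tree_wf k G tr HT HG _ _ Hgl)|].
      apply expressible_conj. intros c Hc. apply in_map_iff in Hc as [x [<- _]].
      apply expressible_CEq. }
    destruct HE as [d [Hd Hdc]].
    destruct (Hw M0 HM0 d Hd) as [s [Hs1 Hs2]].
    { exists a0. apply Hdc. split; auto. apply sat_conj. intros c Hc.
      apply in_map_iff in Hc as [x [<- Hx]]. simpl. rewrite (eval_ground _ _ c0) by apply HV, Hx.
      apply HV; auto. }
    unfold sat_inst in Hs2. apply Hdc in Hs2 as [Hs2 Hs3].
    exists s. split; auto. split; auto. intros x Hx. rewrite sat_conj in Hs3.
    specialize (Hs3 _ (in_map (fun x => CEq (Var x) (theta x)) _ _ Hx)). simpl in Hs3.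
    rewrite (eval_ground _ _ c0) in Hs3 by apply HV, Hx.
    eapply (cet_inj _ _ arF M0 M0_CET (fun _ => fn M0 c0 [])); auto. apply HV; auto.
  - (* safe program: the leaf's variables are determined by those of G *)
    apply ground_instance with a0; auto.
    assert (Hdet : forall x, In x (fvg G) -> denoted arF M0 a0 x).
    { intros x Hx. exists (theta x). split. apply HV; auto.
      rewrite (eval_ground _ _ c0) by apply HV, Hx. apply HV; auto. }
    destruct (branch_vars_denoted Hsafe k G tr a gl a0 HT HG Hgl Hnil Hs Hdet [] a gl eq_refl Hgl)
      as [_ H3].
    intros x Hx. destruct (H3 x Hx) as [u [Hu Hux]]. exists u. split; auto.
    rewrite Hux. apply (eval_ground _ _ c0). apply Hu.
Qed.

Lemma t_answer_sound k : tu_sound k ->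
  herbrand arF c0 M0 \/ witness_property arF c0 Constr Th \/ safe_program arF Th P ->
  forall (G : goal) tr C (theta : nat -> term F), t_tree c0 Constr Th P k G tr -> wf_goal G ->
  (forall x, In x (fvg G) -> gwft arF (theta x)) -> answer c0 tr G C -> sat_inst c0 M0 theta C ->
  true3 (I (OS k)) (map (lsubst theta) (glits G)).
Proof.
  intros Hsound Hcase G tr C theta HT HG Hth [cs [Hcs ->]] HC.
  unfold sat_inst in HC. apply sat_restrict in HC as [a0 [Ha0 HC]].
  apply sat_disj in HC as [c [Hc Hsc]]. destruct (Hcs c Hc) as [a [gl [Hgl [Hnil <-]]]].
  destruct (leaf_ground_instance k G tr a gl a0 theta Hcase HT HG Hgl Hnil Hsc) as [s [Hs1 [Hs2 Hs3]]].
  { intros x Hx. split; auto. }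
  destruct (branch_up_true k G tr s HT HG Hs1 Hsound a gl Hgl Hnil Hs2 a [] G) as [_ HR].
  { rewrite app_nil_r; auto. }
  { apply (proj1 HT). }
  intros l' Hl'. apply in_map_iff in Hl' as [l [<- Hl]].
  rewrite (lsubst_ext _ _ _ s).
  2:{ intros x Hx. symmetry. apply Hs3. unfold fvg. apply in_or_app; right. apply in_flat_map; eauto. }
  specialize (HR l Hl). destruct l as [A|A]; simpl in HR |- *.
  - exact HR.
  - exact (psi_step _ _ arF arR _ k _ HR).
Qed.

(** * Claim (2): replaying a derivation down a tu-tree *)

Lemma merge_subst (tr : tree) b (s thr : nat -> term F) (r : rule F PR PC) pi :
  ground_subst s -> ground_subst thr -> (forall x y, pi x = pi y -> x = y) ->
  (forall x, In x (rule_vars (ren_rule pi r)) -> ~ on_path tr b x) ->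
  exists s', ground_subst s' /\ (forall x, on_path tr b x -> s' x = s x) /\
    (forall x, In x (rule_vars r) -> s' (pi x) = thr x).
Proof.
  intros Hs Hthr Hpi Hfr.
  exists (fun y => match find (fun x => Nat.eqb (pi x) y) (rule_vars r) with
                   | Some x => thr x | None => s y end). split; [|split].
  - intros x. destruct (find _ _); auto.
  - intros y Hy. destruct (find _ _) as [x'|] eqn:E; auto.
    apply find_some in E as [Hx' E]. apply Nat.eqb_eq in E. exfalso. apply (Hfr y); auto.
    apply rule_vars_ren. eauto.
  - intros x Hx. destruct (find _ _) as [x'|] eqn:E.
    + apply find_some in E as [_ E]. apply Nat.eqb_eq, Hpi in E. subst; auto.
    + apply (find_none _ _ E) in Hx. rewrite Nat.eqb_refl in Hx. discriminate.
Qed.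

Lemma resolvent_instance (L body : list (lit F PR)) n (s s' thr : nat -> term F) pi :
  (forall l x, In l L -> In x (fvl l) -> s' x = s x) ->
  (forall l x, In l body -> In x (fvl l) -> s' (pi x) = thr x) ->
  map (lsubst s') (firstn n L ++ map (lsubst (fun x => Var (pi x))) body ++ skipn (S n) L) =
  firstn n (map (lsubst s) L) ++ map (lsubst thr) body ++ skipn (S n) (map (lsubst s) L).
Proof.
  intros HL Hbody. rewrite !map_app, firstn_map, skipn_map. f_equal; [|f_equal].
  - apply map_ext_in. intros l Hl. apply lsubst_ext. intros x Hx. apply (HL l); auto.
    eapply in_firstn; eauto.
  - rewrite map_map. apply map_ext_in. intros l Hl. rewrite lsubst_lsubst. simpl.
    apply lsubst_ext. intros x Hx. apply (Hbody l); auto.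
  - apply map_ext_in. intros l Hl. apply lsubst_ext. intros x Hx. apply (HL l); auto.
    apply (in_skipn (S n)); exact Hl.
Qed.

Lemma fresh_resolvent (tr : tree) b (g : goal) (s : nat -> term F) n A r pi (thr : nat -> term F) :
  tlab tr b = Some g -> nth_error (glits g) n = Some (Pos A) ->
  ground_subst s -> sat M0 (asg s) (gcon g) ->
  ground_subst thr -> sat_inst c0 M0 thr (rcon r) -> asubst s A = asubst thr (rhead r) ->
  (forall x y, pi x = pi y -> x = y) ->
  (forall x, In x (rule_vars (ren_rule pi r)) -> ~ on_path tr b x) ->
  exists s', ground_subst s' /\ (forall x, on_path tr b x -> s' x = s x) /\
    (exists g', derives c0 g n (ren_rule pi r) g') /\
    (forall g', derives c0 g n (ren_rule pi r) g' -> sat M0 (asg s') (gcon g') /\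
       map (lsubst s') (glits g') = firstn n (map (lsubst s) (glits g)) ++ map (lsubst thr) (rbody r) ++
                                    skipn (S n) (map (lsubst s) (glits g))).
Proof.
  intros Hg Hn Hs Hsat Hthr Hsr Heq Hpi Hfr.
  destruct (merge_subst tr b s thr r pi Hs Hthr Hpi Hfr) as [s' [Hs' [Hoff Hpi']]].
  assert (Hgv : forall x, In x (goal_vars g) -> s' x = s x).
  { intros x Hx. apply Hoff. exists b, [], g. auto. }
  assert (Hlitin : forall l, In l (glits g) -> forall x, In x (fvl l) -> s' x = s x).
  { intros l Hl x Hx. apply Hgv. unfold goal_vars. apply in_or_app; right. apply in_flat_map; eauto. }
  exists s'. split; [exact Hs'|]. split; [exact Hoff|].
  destruct A as [p ts]. destruct r as [[q us0] cr br]. simpl in Heq. injection Heq as <- Hts.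
  assert (Hlen : length ts = length (map (tren pi) us0)).
  { rewrite length_map. rewrite <- (length_map (tsubst s) ts), Hts, length_map. auto. }
  (* the resolvent exists, the selected atom and the head having the same arity *)
  split.
  { exists (Goal (CAnd (eqs c0 ts (map (tren pi) us0)) (CAnd (gcon g) (cren pi cr)))
        (firstn n (glits g) ++ map (lsubst (fun x => Var (pi x))) br ++ skipn (S n) (glits g))).
    exists p, ts, (map (tren pi) us0). repeat split; auto. }
  intros g' [p' [ts' [us' [Hn' [Hh' [Hl' ->]]]]]].
  rewrite Hn in Hn'. injection Hn' as <- <-. simpl in Hh'. injection Hh' as <-. simpl.
  assert (Hts' : map (tsubst s') ts = map (tsubst s) ts).
  { apply map_ext_in. intros t Ht. apply tsubst_ext. intros x Hx.
    apply (Hlitin (Pos (RA p ts))). eapply nth_error_In; eauto. unfold fvl; simpl. unfold fvts.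
    apply in_flat_map; eauto. }
  assert (Hus' : map (tsubst s') (map (tsubst (fun x => Var (pi x))) us0) = map (tsubst thr) us0).
  { rewrite map_map. apply map_ext_in. intros u Hu. rewrite tsubst_tsubst. simpl.
    apply tsubst_ext. intros x Hx. apply Hpi'. unfold rule_vars. simpl. apply in_or_app; left.
    unfold fvts. apply in_flat_map; eauto. }
  split; [split; [|split]|].
  - apply sat_eqs; auto.
    assert (Hme : forall L, map (eval M0 (asg s')) L = map (geval c0 M0) (map (tsubst s') L)).
    { intros L. rewrite map_map. apply map_ext. intros; symmetry; apply geval_tsubst. }
    rewrite !Hme. change (map (tren pi) us0) with (map (tsubst (fun x => Var (pi x))) us0).
    rewrite Hts', Hus', Hts. reflexivity.
  - revert Hsat. apply sat_ext. intros x Hx. rewrite Hgv; auto. unfold goal_vars.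
    apply in_or_app; left. apply fvc_varsc; auto.
  - apply sat_cren; auto. unfold sat_inst in Hsr. simpl in Hsr. revert Hsr. apply sat_ext.
    intros x Hx. rewrite Hpi'; auto. unfold rule_vars. simpl. apply in_or_app; right; apply in_or_app; left.
    apply fvc_varsc; auto.
  - apply resolvent_instance; [intros l x Hl Hx; apply (Hlitin l); auto|].
    intros l x Hl Hx. apply Hpi'. unfold rule_vars. simpl. apply in_or_app; right; apply in_or_app; right.
    apply in_flat_map; eauto.
Qed.

Lemma nanswer_excludes (tr : tree) (G : goal) C s0 : nanswer c0 Constr Th tr G C ->
  sat M0 (asg s0) C ->
  exists S, cross_section tr S /\
    forall b g s, S b -> tlab tr b = Some g -> sat M0 (asg s) (gcon g) ->
      (forall x, In x (fvg G) -> s x = s0 x) -> False.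
Proof.
  intros [S [HS HCase]] HsC. exists S. split; auto. intros b g s Hb Hg Hs Hag.
  assert (Hr : sat M0 (asg s0) (restrict (gcon g) (fvg G))).
  { apply sat_restrict. exists (asg s). split; auto. intros x Hx. rewrite Hag; auto. }
  assert (HNC : exists a g', S a /\ tlab tr a = Some g' /\ gcon g' = gcon g) by eauto.
  destruct HCase as [[cs [Hcs ->]]|[_ [_ [_ Hent]]]].
  - apply Hcs in HNC. rewrite sat_conj in HsC.
    apply (HsC (CNot (restrict (gcon g) (fvg G)))); auto. apply in_map_iff. eauto.
  - apply (Hent _ HNC M0 HM0 _ HsC). exact Hr.
Qed.

Section DownTheBranch.
Variables (k : ord) (G : goal) (tr : tree) (s0 : nat -> term F).
Hypothesis HT : tu_tree c0 Constr Th P k G tr.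
Hypothesis HG : wf_goal G.
Hypothesis Hsound : t_sound k.

Definition reached b (g : goal) (s : nat -> term F) : Prop :=
  tlab tr b = Some g /\ ground_subst s /\
  (forall c b' g', b = c ++ b' -> tlab tr b' = Some g' -> sat M0 (asg s) (gcon g')) /\
  (forall x, In x (fvg G) -> s x = s0 x).

Lemma reached_root : ground_subst s0 -> sat M0 (asg s0) (gcon G) -> reached [] G s0.
Proof.
  intros Hs0 HsG. split; [apply HT|]. split; auto. split; auto.
  intros c b' g' Hc Hb'. apply eq_sym, app_eq_nil in Hc as [-> ->].
  rewrite (proj1 HT) in Hb'. injection Hb' as <-. auto.
Qed.

Lemma reached_child b g s i g' s' : reached b g s -> tlab tr (i :: b) = Some g' ->
  ground_subst s' -> (forall x, on_path tr b x -> s' x = s x) -> sat M0 (asg s') (gcon g') ->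
  reached (i :: b) g' s'.
Proof.
  intros [Hg [Hs [Hanc Hag]]] Hg' Hs' Hoff Hsat'. split; auto. split; auto. split.
  - intros [|j c] b' g0 Hc Hb'.
    + simpl in Hc; subst. rewrite Hg' in Hb'. injection Hb' as <-. auto.
    + simpl in Hc. injection Hc as _ Hc. assert (H := Hanc c b' g0 Hc Hb'). revert H.
      apply sat_ext. intros x Hx. rewrite Hoff; auto. subst. eapply on_path_anc; eauto.
  - intros x Hx. rewrite Hoff, Hag; auto. exists [], b, G. rewrite app_nil_r.
    split; auto. split; [apply HT|]. unfold fvg, goal_vars in *.
    apply in_app_iff in Hx as [Hx|Hx]; apply in_or_app; auto. left; apply fvc_varsc; auto.
Qed.

Lemma reached_pos b g s A ls : reached b g s ->
  nth_error (glits g) (tsel tr b) = Some (Pos A) -> Q (asubst s A) ls ->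
  exists i g' s', reached (i :: b) g' s' /\
    map (lsubst s') (glits g') = firstn (tsel tr b) (map (lsubst s) (glits g)) ++ ls ++
                                 skipn (S (tsel tr b)) (map (lsubst s) (glits g)).
Proof.
  intros HR El [r [HPr [thr [Hthr [Hsr [Heq ->]]]]]].
  pose proof HR as [Hg [Hs [Hanc _]]].
  assert (Hsg : sat M0 (asg s) (gcon g)) by (apply (Hanc [] b g); auto).
  destruct (selected_step _ _ _ _ _ _ _ _ _ HT b g _ Hg El) as [_ Hac].
  destruct (fresh_perm (on_path tr b) (rule_vars r) (on_path_bound _ _ _ tr b))
    as [pi [Hpi [Hsurj Hfr]]].
  assert (Hfr' : forall x, In x (rule_vars (ren_rule pi r)) -> ~ on_path tr b x).
  { intros x Hx. apply rule_vars_ren in Hx as [x' [Hx' ->]]. auto. }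
  (* the fresh variant pi shows that the child for r exists ... *)
  destruct (fresh_resolvent tr b g s _ A r pi thr Hg El Hs Hsg Hthr Hsr Heq Hpi Hfr')
    as [s1 [Hs1 [Ho1 [[g1 Hd1] Hc1]]]].
  destruct (tlab tr (Some r :: b)) as [g'|] eqn:Eg'.
  2:{ exfalso. apply (proj2 (Hac r) HPr); auto. exists (ren_rule pi r), g1. split.
      { exists pi. auto. } split; auto. split; auto. exists M0. split; auto.
      exists (asg s1). apply (Hc1 g1 Hd1). }
  (* ... and the variant actually used there is fresh as well *)
  destruct (proj1 (Hac r) g' Eg') as [_ [r'' [Hv [Hfr'' [Hd'' _]]]]].
  destruct (variant_ren _ _ Hv) as [pi'' [Hpi'' ->]].
  destruct (fresh_resolvent tr b g s _ A r pi'' thr Hg El Hs Hsg Hthr Hsr Heq Hpi'' Hfr'')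
    as [s2 [Hs2 [Ho2 [_ Hc2]]]].
  destruct (Hc2 g' Hd'') as [Hsat2 Hmap2].
  exists (Some r), g', s2. split; auto. eapply reached_child; eauto.
Qed.

(* Resolving a selected negative literal whose atom is false in I_k: by
   claim (1) at rank k the answers for that atom are not satisfied, so the
   tu-tree does not stop there and the child is reached under the same s. *)
Lemma reached_neg b g s A : reached b g s ->
  nth_error (glits g) (tsel tr b) = Some (Neg A) -> ~ I k (Pos (asubst s A)) ->
  exists g', reached (None :: b) g' s /\ glits g' = rest_of g (tsel tr b).
Proof.
  intros HR El HnA. pose proof HR as [Hg [Hs [Hanc _]]].
  assert (Hsg : sat M0 (asg s) (gcon g)) by (apply (Hanc [] b g); auto).
  assert (HGi := wf_goal_single _ _ (tu_tree_wf k G tr HT HG _ _ Hg) (nth_error_In _ _ El)).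
  assert (HnC : forall C'', t_answers k (Goal (gcon g) [Pos A]) C'' -> ~ sat M0 (asg s) C'').
  { intros C'' HC'' Hs''. apply HnA. apply (Hsound _ _ s HGi Hs HC'' Hs''). simpl; auto. }
  destruct (selected_step _ _ _ _ _ _ _ _ _ HT b g _ Hg El)
    as [[Hsc _]|[[C'' [HC'' [_ [Hsc _]]]]|[_ [C'' [HC'' Hunsat]]]]].
  - exists (Goal (gcon g) (rest_of g (tsel tr b))). split; auto.
    apply (reached_child b g s); auto.
  - exists (Goal (CAnd (CNot C'') (gcon g)) (rest_of g (tsel tr b))). split; auto.
    apply (reached_child b g s); auto. split; [apply (HnC C''); auto | exact Hsg].
  - exfalso. apply Hunsat. exists M0. split; auto. exists (asg s). simpl.
    split; [apply (HnC C''); auto | auto].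
Qed.

(* Main induction: a node reached under s whose instance is derivable in
   the least model computing the negative part of I_(k+1) leads, along the
   derivation, to a reached node of the cross-section, which is excluded. *)
Variable S : addr F PR PC -> Prop.
Hypothesis HS : cross_section tr S.
Hypothesis Hexcl : forall b g s, S b -> tlab tr b = Some g -> sat M0 (asg s) (gcon g) ->
  (forall x, In x (fvg G) -> s x = s0 x) -> False.

Lemma derivable_unreachable :
  forall L, Derivable Q (fun b => gwfa arF arR b /\ ~ I k (Pos b)) L ->
  forall b g s, reached b g s -> L = map (lsubst s) (glits g) -> False.
Proof.
  intros L HL. induction HL as [L Hneg Hpos] using Derivable_ind'.
  intros b g s HR ->. pose proof HR as [Hg [_ [Hanc Hag]]].
  destruct (glits g) as [|l0 ls0] eqn:E.
  - (* a successful node lies below a node of the cross-section *)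
    destruct (proj2 HS b) as [b'' [c [Hc HSb]]]. { exists g; auto. }
    destruct (tlab tr b'') as [g''|] eqn:Eg''. 2:{ apply (proj1 HS) in HSb. contradiction. }
    eapply (Hexcl b'' g'' s); eauto.
  - rewrite <- E in *. destruct (proj2 (proj2 HT) b g Hg) as [_ [Hlt _]]. { congruence. }
    destruct (nth_error (glits g) (tsel tr b)) as [[A|A]|] eqn:El.
    3:{ apply nth_error_None in El. lia. }
    + destruct (Hpos (tsel tr b) (asubst s A)) as [ls [HQ [_ IH]]].
      { rewrite nth_error_map, El. reflexivity. }
      destruct (reached_pos b g s A ls HR El HQ) as [i [g' [s' [HR' Hmap]]]].
      apply (IH _ _ _ HR'). auto.
    + destruct (Hneg (tsel tr b) (asubst s A)) as [[_ HnA] [_ IH]].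
      { rewrite nth_error_map, El. reflexivity. }
      destruct (reached_neg b g s A HR El HnA) as [g' [HR' Hl']].
      apply (IH _ _ _ HR'). rewrite Hl'. unfold rest_of. rewrite map_app, firstn_map, skipn_map.
      reflexivity.
Qed.

End DownTheBranch.

Lemma not_false_derivable k (L : list (lit F PR)) s : ground_subst s -> Forall (wfl arF arR) L ->
  ~ false3 (I (OS k)) (map (lsubst s) L) ->
  Derivable Q (fun b => gwfa arF arR b /\ ~ I k (Pos b)) (map (lsubst s) L).
Proof.
  intros Hs HW Hnf. apply Derivable_list. intros l Hl. apply in_map_iff in Hl as [l0 [<- Hl0]].
  rewrite Forall_forall in HW. specialize (HW l0 Hl0).
  assert (Hgw : forall A, l0 = Pos A \/ l0 = Neg A -> gwfa arF arR (asubst s A)).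
  { intros A [->| ->]; apply gwfa_asubst; auto. }
  destruct l0 as [A|A]; simpl.
  - apply lhm_Derivable. apply NNPP. intros Hn. apply Hnf. exists (Pos (asubst s A)). split.
    + apply in_map_iff. exists (Pos A); auto.
    + simpl. split; auto.
  - apply Derivable_neg. split; auto. intros HIk. apply Hnf. exists (Neg (asubst s A)). split.
    + apply in_map_iff. exists (Neg A); auto.
    + exact (psi_step _ _ arF arR _ k _ HIk).
Qed.

Definition ground_extension (G : goal) (theta : nat -> term F) : nat -> term F :=
  fun x => if in_dec Nat.eq_dec x (fvg G) then theta x else App c0 [].

Lemma ground_extension_ok (G : goal) theta : (forall x, In x (fvg G) -> gwft arF (theta x)) ->
  ground_subst (ground_extension G theta) /\ (forall x, In x (fvg G) -> ground_extension G theta x = theta x).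
Proof.
  intros H. split.
  - intros x. unfold ground_extension. destruct (in_dec _ _ _); auto. split; simpl; auto.
  - intros x Hx. unfold ground_extension. destruct (in_dec _ _ _); tauto.
Qed.

Lemma tu_answer_sound k : t_sound k ->
  forall (G : goal) tr C (theta : nat -> term F), tu_tree c0 Constr Th P k G tr -> wf_goal G ->
  (forall x, In x (fvg G) -> gwft arF (theta x)) -> nanswer c0 Constr Th tr G C ->
  sat_inst c0 M0 theta (gcon G) -> sat_inst c0 M0 theta C ->
  false3 (I (OS k)) (map (lsubst theta) (glits G)).
Proof.
  intros Hsound G tr C theta HT HG Hth HC HsG HsC. apply NNPP. intros Hnf.
  destruct (ground_extension_ok G theta Hth) as [Hs0 Hag].
  set (s0 := ground_extension G theta) in *.
  assert (Hsame : forall c, (forall x, In x (fvc c) -> In x (fvg G)) ->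
            sat_inst c0 M0 theta c -> sat M0 (asg s0) c).
  { intros c Hc. apply sat_ext. intros x Hx. rewrite Hag; auto. }
  assert (Hmap : map (lsubst theta) (glits G) = map (lsubst s0) (glits G)).
  { apply map_ext_in. intros l Hl. apply lsubst_ext. intros x Hx. rewrite Hag; auto.
    unfold fvg. apply in_or_app; right. apply in_flat_map; eauto. }
  rewrite Hmap in Hnf.
  destruct (nanswer_excludes tr G C s0 HC) as [S [HS Hexcl]].
  { apply Hsame; auto. apply (nanswer_fv tr G C HC). }
  apply (derivable_unreachable k G tr s0 HT HG Hsound S HS Hexcl _
           (not_false_derivable k (glits G) s0 Hs0 (proj2 HG) Hnf) [] G s0).
  - apply (reached_root k); auto. apply Hsame; auto. intros x Hx. unfold fvg. apply in_or_app; auto.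
  - reflexivity.
Qed.

Hypothesis Hcase : herbrand arF c0 M0 \/ witness_property arF c0 Constr Th \/ safe_program arF Th P.

Lemma tree_answers_sound k : t_sound k /\ tu_sound k.
Proof.
  induction k as [|k [IH1 IH2]|f IH].
  - split; intros ? ? ?; simpl; contradiction.
  - split.
    + intros G C s HG Hs [H|[tr [HT HA]]] Hc.
      * intros l Hl. apply (psi_step _ _ arF arR _ k l). apply (IH1 G C s); auto.
      * eapply t_answer_sound; eauto.
    + intros G C s HG Hs [H|[tr [HT HA]]] HcG Hc.
      * destruct (IH2 G C s HG Hs H HcG Hc) as [l [Hl Hf]]. exists l. split; auto.
        destruct l; exact (psi_step _ _ arF arR _ k _ Hf).
      * eapply tu_answer_sound; eauto.
  - split.
    + intros G C s HG Hs [n H] Hc l Hl. exists n. apply (proj1 (IH n) G C s); auto.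
    + intros G C s HG Hs [n H] HcG Hc. destruct (proj2 (IH n) G C s HG Hs H HcG Hc) as [l [Hl Hf]].
      exists l. split; auto. destruct l; simpl in *; exists n; auto.
Qed.

End Soundness.

Theorem mainTheorem5
  (F PR PC : Type) (arF : F -> nat) (arR : PR -> nat) (arC : PC -> nat)
  (c0 : F) (Hc0 : arF c0 = 0)
  (Constr : cform F PC -> Prop) (Th : cform F PC -> Prop) (P : rule F PR PC -> Prop)
  (HConstr : @constraint_language F PC Constr)
  (HTh : @theory_ok F PC arF arC Th)
  (HP : @hybrid_program F PR PC arF arR arC Constr P)
  (G : goal F PR PC) (HG : @goal_ok F PR PC arF arR Constr G)
  (M0 : structure F PC) (HM0 : @model F PC Th M0)
  (k : ord)
  (Hcase : @herbrand F PC arF c0 M0 \/ @witness_property F PC arF c0 Constr Th \/ @safe_program F PR PC arF Th P)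
  (theta : nat -> term F) (Htheta : forall x, In x (@fvg F PR PC G) -> @gwft F arF (theta x)) :
  (forall (tr : tree F PR PC) (C : cform F PC),
     @t_tree F PR PC c0 Constr Th P k G tr -> @answer F PR PC c0 tr G C ->
     @sat_inst F PC c0 M0 theta C ->
     @true3 F PR (@psi_up F PR arF arR (@ground_prog F PR PC arF c0 P M0) (OS k)) (map (@lsubst F PR theta) (@glits F PR PC G))) /\
  (forall (tr : tree F PR PC) (C : cform F PC),
     @tu_tree F PR PC c0 Constr Th P k G tr -> @nanswer F PR PC c0 Constr Th tr G C ->
     @sat_inst F PC c0 M0 theta (@gcon F PR PC G) -> @sat_inst F PC c0 M0 theta C ->
     @false3 F PR (@psi_up F PR arF arR (@ground_prog F PR PC arF c0 P M0) (OS k)) (map (@lsubst F PR theta) (@glits F PR PC G))).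
Proof.
  assert (HG' := wf_goal_ok F PC Constr PR arF arR G HG).
  destruct (tree_answers_sound F PC c0 Constr HConstr PR arF arR arC Th P HP Hc0 HTh M0 HM0 Hcase k)
    as [Ht Htu].
  split; intros; [eapply t_answer_sound | eapply tu_answer_sound]; eauto.
Qed.
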